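(* Let $\Bbbk$ be a field of characteristic $0$. For any cocommutative connected bimonoid $\mathbf{h}$ in species over $\Bbbk$, there is an isomorphism of comonoids $$\mathcal{S}(\mathcal{P}(\mathbf{h}))\xrightarrow{\ \cong\ }\mathbf{h}.$$
   Context: Species and bimonoids. A species is a functor $\mathbf{p}$ from the category of finite sets and bijections to $\Bbbk$-vector spaces; morphisms are natural transformations. $I=S\sqcup T$ means that $(S,T)$ is an ordered pair of disjoint, possibly empty, subsets with union $I$. The Cauchy product is $(\mathbf{p}\cdot\mathbf{q})[I]=\bigoplus_{I=S\sqcup T}\mathbf{p}[S]\otimes\mathbf{q}[T]$; with the symmetry $x\otimes y\mapsto y\otimes x$ and unit the species that is $\Bbbk$ on $\emptyset$ and $0$ elsewhere, species form a symmetric monoidal category. Monoids, comonoids and bimonoids are taken in this category, with structure maps $\mu_{S,T},\iota_\emptyset$ (product $\mathbf{a}[S]\otimes\mathbf{a}[T]\to\mathbf{a}[I]$, unit) and $\Delta_{S,T},\epsilon_\emptyset$ (coproduct $\mathbf{c}[I]\to\mathbf{c}[S]\otimes\mathbf{c}[T]$, counit); in a bimonoid, product and unit are morphisms of comonoids. Cocommutative means that $\Delta_{T,S}$ equals $\Delta_{S,T}$ followed by the swap. A bimonoid is connected if $\dim\mathbf{h}[\emptyset]=1$. The primitive part $\mathcal{P}(\mathbf{h})$ is the species with $\mathcal{P}(\mathbf{h})[\emptyset]=0$ and, for $I\neq\emptyset$, $\mathcal{P}(\mathbf{h})[I]=\bigcap_{I=S\sqcup T,\ S,T\ne\emptyset}\ker\Delta_{S,T}$.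 For a species $\mathbf{q}$ with $\mathbf{q}[\emptyset]=0$, $\mathcal{S}(\mathbf{q})$ is the species $\mathcal{S}(\mathbf{q})[I]=\bigoplus_{X\vdash I}\mathbf{q}(X)$, the sum over all partitions $X$ of $I$ into nonempty blocks, where $\mathbf{q}(X)=\bigotimes_{B\in X}\mathbf{q}[B]$ (unordered tensor product; for $I=\emptyset$ there is one partition, with $\mathbf{q}(X)=\Bbbk$). Its comonoid structure has $\epsilon_\emptyset=\mathrm{id}_\Bbbk$ and coproduct $\Delta_{S,T}$ that on $\mathbf{q}(X)$ is $\bigotimes_{B\in X}x_B\mapsto\bigl(\bigotimes_{B\in X,\,B\subseteq S}x_B\bigr)\otimes\bigl(\bigotimes_{B\in X,\,B\subseteq T}x_B\bigr)$ if every block of $X$ is contained in $S$ or in $T$, and $0$ otherwise. *)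

(* Defs.v *)
From HB Require Import structures.
From mathcomp Require Import all_boot all_algebra.
From mathcomp Require Import boolp.

Set Implicit Arguments.
Unset Strict Implicit.
Unset Printing Implicit Defensive.

Import GRing.Theory.
Local Open Scope quotient_scope.
Local Open Scope ring_scope.

(* [umod P] is the module generated by [X], universal for the maps
   [f : X -> W] with [P W f]: formal linear combinations of elements of [X], two
   of them being identified when all such [f] evaluate them equally.  For [P]
   the (multi)linear maps it is the tensor product of arbitrary, possibly
   infinite-dimensional, spaces: the universal property is [tens_bilin],
   [tliftE] (existence), [tens_ext] (uniqueness), resp. [mtens_multilin],
   [mliftE], [mtens_ext]. *)
Section UniversalModule.
Variables (K : fieldType) (X : choiceType).
Variable P : forall W : lmodType K, (X -> W) -> Prop.

Definition fev (W : lmodType K) (f : X -> W) (s : seq (K * X)) : W :=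
  \sum_(p <- s) p.1 *: f p.2.

Definition feq (s t : seq (K * X)) : bool :=
  `[< forall (W : lmodType K) (f : X -> W), P f -> fev f s = fev f t >].

Lemma feq_refl : reflexive feq.
Proof. by move=> s; apply/asboolP. Qed.

Lemma feq_sym : symmetric feq.
Proof. by move=> s t; apply/asboolP/asboolP => h W f Pf; rewrite h. Qed.

Lemma feq_trans : transitive feq.
Proof.
by move=> t s u /asboolP h1 /asboolP h2; apply/asboolP => W f Pf; rewrite h1 ?h2.
Qed.

Canonical feq_equiv := EquivRel feq feq_refl feq_sym feq_trans.

Definition umod := {eq_quot feq}.
HB.instance Definition _ := Choice.on umod.

Definition upi (s : seq (K * X)) : umod := \pi_umod s.
Definition ugen (x : X) : umod := upi [:: (1, x)].

Definition ulift (W : lmodType K) (f : X -> W) (Pf : P f) (a : umod) : W :=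
  fev f (repr a).

Lemma ulift_pi (W : lmodType K) (f : X -> W) (Pf : P f) s :
  ulift Pf (upi s) = fev f s.
Proof.
have /eqmodP/asboolP : repr (upi s) = s %[mod umod] by rewrite reprK.
exact.
Qed.

Lemma ulift_inj (a b : umod) :
  (forall (W : lmodType K) (f : X -> W) (Pf : P f), ulift Pf a = ulift Pf b) ->
  a = b.
Proof.
move=> h; rewrite -[a]reprK -[b]reprK; apply/eqmodP/asboolP => W f Pf.
exact: (h W f Pf).
Qed.

Definition uzero : umod := upi [::].
Definition uadd (a b : umod) : umod := upi (repr a ++ repr b).
Definition uscale (c : K) (a : umod) : umod :=
  upi [seq (c * p.1, p.2) | p <- repr a].
Definition uopp (a : umod) : umod := uscale (-1) a.

Section Lift.
Variables (W : lmodType K) (f : X -> W) (Pf : P f).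

Lemma ulift0 : ulift Pf uzero = 0.
Proof. by rewrite ulift_pi /fev big_nil. Qed.

Lemma uliftD a b : ulift Pf (uadd a b) = ulift Pf a + ulift Pf b.
Proof. by rewrite ulift_pi /fev big_cat. Qed.

Lemma uliftZ c a : ulift Pf (uscale c a) = c *: ulift Pf a.
Proof.
rewrite ulift_pi /fev big_map scaler_sumr; apply: eq_bigr => p _.
by rewrite scalerA.
Qed.

Lemma uliftN a : ulift Pf (uopp a) = - ulift Pf a.
Proof. by rewrite uliftZ scaleN1r. Qed.

Lemma ulift_gen x : ulift Pf (ugen x) = f x.
Proof. by rewrite ulift_pi /fev big_seq1 scale1r. Qed.
End Lift.

Lemma uaddA : associative uadd.
Proof. by move=> a b c; apply: ulift_inj => W f Pf; rewrite !uliftD addrA. Qed.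

Lemma uaddC : commutative uadd.
Proof. by move=> a b; apply: ulift_inj => W f Pf; rewrite !uliftD addrC. Qed.

Lemma uadd0 : left_id uzero uadd.
Proof. by move=> a; apply: ulift_inj => W f Pf; rewrite uliftD ulift0 add0r. Qed.

Lemma uaddN : left_inverse uzero uopp uadd.
Proof.
by move=> a; apply: ulift_inj => W f Pf; rewrite uliftD uliftN ulift0 addNr.
Qed.

HB.instance Definition _ := GRing.isZmodule.Build umod uaddA uaddC uadd0 uaddN.

Lemma uscaleA c d a : uscale c (uscale d a) = uscale (c * d) a.
Proof. by apply: ulift_inj => W f Pf; rewrite !uliftZ scalerA. Qed.

Lemma uscale1 : left_id 1 uscale.
Proof. by move=> a; apply: ulift_inj => W f Pf; rewrite uliftZ scale1r. Qed.

Lemma uscaleDr : right_distributive uscale +%R.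
Proof.
by move=> c a b; apply: ulift_inj => W f Pf; rewrite !(uliftZ, uliftD) scalerDr.
Qed.

Lemma uscaleDl a : {morph uscale^~ a : c d / c + d}.
Proof.
by move=> c d; apply: ulift_inj => W f Pf; rewrite !(uliftZ, uliftD) scalerDl.
Qed.

HB.instance Definition _ := GRing.Zmodule_isLmodule.Build K umod
  uscaleA uscale1 uscaleDr uscaleDl.

Lemma ulift_linear (W : lmodType K) (f : X -> W) (Pf : P f) : linear (ulift Pf).
Proof. by move=> c a b; rewrite uliftD uliftZ. Qed.

HB.instance Definition _ (W : lmodType K) (f : X -> W) (Pf : P f) :=
  GRing.isLinear.Build K umod W *:%R (ulift Pf) (ulift_linear Pf).

Lemma umod_gens (a : umod) : a = \sum_(p <- repr a) p.1 *: ugen p.2.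
Proof.
apply: ulift_inj => W f Pf; rewrite raddf_sum /=.
by apply: eq_bigr => p _; rewrite linearZ /= ulift_gen.
Qed.

Lemma umod_ext (W : lmodType K) (f g : {linear umod -> W}) :
  (forall x, f (ugen x) = g (ugen x)) -> f =1 g.
Proof.
move=> h a; rewrite [a]umod_gens !raddf_sum.
by apply: eq_bigr => p _ /=; rewrite !linearZ h.
Qed.

Lemma umod_ind (Q : umod -> Prop) : Q 0 ->
  (forall c a b, Q a -> Q b -> Q (c *: a + b)) -> (forall x, Q (ugen x)) ->
  forall a, Q a.
Proof.
move=> Q0 QP Qg a; rewrite [a]umod_gens; elim: (repr a) => [|p r IH].
  by rewrite big_nil.
by rewrite big_cons; apply: QP.
Qed.
End UniversalModule.

Section Tensor2.
Variable K : fieldType.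
Implicit Types U V W : lmodType K.

Definition bilin U V W (f : U * V -> W) : Prop :=
  (forall v, linear (fun u => f (u, v))) /\
  (forall u, linear (fun v => f (u, v))).

Definition tens U V : lmodType K := umod (@bilin U V).

Definition tpure U V (u : U) (v : V) : tens U V := ugen (@bilin U V) (u, v).

Lemma tens_bilin U V : bilin (fun p : U * V => tpure p.1 p.2).
Proof.
split=> [v c x y|u c x y] /=; apply: ulift_inj => W f Pf;
  rewrite linearP /= !ulift_gen; exact: (proj1 Pf) || exact: (proj2 Pf).
Qed.

Definition tlift U V W (f : U * V -> W) (bf : bilin f) : tens U V -> W :=
  ulift (P := @bilin U V) bf.
HB.instance Definition _ U V W (f : U * V -> W) (bf : bilin f) :=
  GRing.Linear.on (tlift bf).

Lemma tliftE U V W (f : U * V -> W) (bf : bilin f) u v :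
  tlift bf (tpure u v) = f (u, v).
Proof. exact: ulift_gen. Qed.

Lemma tens_ext U V W (f g : {linear tens U V -> W}) :
  (forall u v, f (tpure u v) = g (tpure u v)) -> f =1 g.
Proof. by move=> h; apply: umod_ext => -[u v]; apply: h. Qed.

Lemma tens_ind U V (Q : tens U V -> Prop) : Q 0 ->
  (forall c a b, Q a -> Q b -> Q (c *: a + b)) ->
  (forall u v, Q (tpure u v)) -> forall a, Q a.
Proof. by move=> Q0 QP Qg; apply: umod_ind => // -[u v]; apply: Qg. Qed.

Lemma tens_linear U V W Y (F : Y -> {linear tens U V -> W}) y1 y2 y3 (c : K) :
  (forall u v, F y1 (tpure u v) = c *: F y2 (tpure u v) + F y3 (tpure u v)) ->
  forall x, F y1 x = c *: F y2 x + F y3 x.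
Proof.
move=> h; apply: tens_ind => [|k a b IHa IHb|//].
  by rewrite !linear0 addr0.
by rewrite !linearP IHa IHb !scalerDr !scalerA [k * c]mulrC addrACA.
Qed.

Lemma tpurePl U V c u u' (v : V) :
  tpure (c *: u + u' : U) v = c *: tpure u v + tpure u' v.
Proof. exact: (proj1 (tens_bilin U V)). Qed.

Lemma tpurePr U V c (u : U) v v' :
  tpure u (c *: v + v' : V) = c *: tpure u v + tpure u v'.
Proof. exact: (proj2 (tens_bilin U V)). Qed.

Lemma tpure0l U V (v : V) : tpure (0 : U) v = 0.
Proof. by have := tpurePl (-1) (0 : U) 0 v; rewrite scaler0 addr0 scaleN1r addNr. Qed.

Lemma tpure0r U V (u : U) : tpure u (0 : V) = 0.
Proof. by have := tpurePr (-1) u (0 : V) 0; rewrite scaler0 addr0 scaleN1r addNr. Qed.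

Section Map.
Variables (U U' V V' : lmodType K).
Variables (f : {linear U -> U'}) (g : {linear V -> V'}).

Lemma tmap_bilin : bilin (fun p : U * V => tpure (f p.1) (g p.2)).
Proof. by split=> [v c x y|u c x y] /=; rewrite linearP (tpurePl, tpurePr). Qed.

Definition tmap : tens U V -> tens U' V' :=
  tlift tmap_bilin.
HB.instance Definition _ := GRing.Linear.on tmap.

Lemma tmapE u v : tmap (tpure u v) = tpure (f u) (g v).
Proof. exact: tliftE. Qed.
End Map.

Section Symmetry.
Variables U V : lmodType K.

Lemma tswap_bilin : bilin (fun p : U * V => tpure p.2 p.1).
Proof. by split=> [v c x y|u c x y] /=; rewrite (tpurePl, tpurePr). Qed.

Definition tswap : tens U V -> tens V U :=
  tlift tswap_bilin.
HB.instance Definition _ := GRing.Linear.on tswap.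

Lemma tswapE u v : tswap (tpure u v) = tpure v u.
Proof. exact: tliftE. Qed.

Lemma tunitl_bilin : bilin (fun p : K^o * V => (p.1 : K) *: p.2).
Proof.
split=> [v c x y|u c x y] /=; first by rewrite scalerDl scalerA.
by rewrite scalerDr !scalerA mulrC.
Qed.

Definition tunitl : tens K^o V -> V :=
  tlift tunitl_bilin.
HB.instance Definition _ := GRing.Linear.on tunitl.

Lemma tunitlE c v : tunitl (tpure c v) = (c : K) *: v.
Proof. exact: tliftE. Qed.

Lemma tunitr_bilin : bilin (fun p : V * K^o => (p.2 : K) *: p.1).
Proof.
split=> [v c x y|u c x y] /=; last by rewrite scalerDl scalerA.
by rewrite scalerDr !scalerA mulrC.
Qed.

Definition tunitr : tens V K^o -> V :=
  tlift tunitr_bilin.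
HB.instance Definition _ := GRing.Linear.on tunitr.

Lemma tunitrE c v : tunitr (tpure v c) = (c : K) *: v.
Proof. exact: tliftE. Qed.
End Symmetry.

Section Assoc.
Variables U V W : lmodType K.

Lemma tassoc1_bilin (w : W) :
  bilin (fun p : U * V => tpure p.1 (tpure p.2 w)).
Proof. by split=> [v c x y|u c x y] /=; rewrite ?tpurePl ?tpurePr. Qed.

Lemma tassoc_bilin : bilin (fun p : tens U V * W => tlift (tassoc1_bilin p.2) p.1).
Proof.
split=> [w c x y|x c w w'] /=; first by rewrite linearP.
apply: (tens_linear (F := fun w0 => tlift (tassoc1_bilin w0) : {linear _ -> _})) => u v /=.
by rewrite !tliftE /= !tpurePr.
Qed.

Definition tassoc : tens (tens U V) W -> tens U (tens V W) :=
  tlift tassoc_bilin.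
HB.instance Definition _ := GRing.Linear.on tassoc.

Lemma tassocE u v w : tassoc (tpure (tpure u v) w) = tpure u (tpure v w).
Proof. by rewrite /tassoc tliftE /= tliftE. Qed.
End Assoc.

Section Interchange.
Variables A B C D : lmodType K.

Lemma tinter1_bilin (c : C) (d : D) :
  bilin (fun p : A * B => tpure (tpure p.1 c) (tpure p.2 d)).
Proof. by split=> [v k x y|u k x y] /=; rewrite ?tpurePl ?tpurePr. Qed.

Lemma tinter2_bilin (x : tens A B) :
  bilin (fun p : C * D => tlift (tinter1_bilin p.1 p.2) x).
Proof.
split=> [d k y z|c k y z] /=.
  apply: (tens_linear (F := fun c0 => tlift (tinter1_bilin c0 d) : {linear _ -> _})) => u v /=.
  by rewrite !tliftE /= tpurePr tpurePl.
apply: (tens_linear (F := fun d0 => tlift (tinter1_bilin c d0) : {linear _ -> _})) => u v /=.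
by rewrite !tliftE /= !tpurePr.
Qed.

Lemma tinter_bilin :
  bilin (fun p : tens A B * tens C D => tlift (tinter2_bilin p.1) p.2).
Proof.
split=> [y k x x'|x k y y'] /=; last by rewrite linearP.
apply: (tens_linear (F := fun x0 => tlift (tinter2_bilin x0) : {linear _ -> _})) => c d /=.
by rewrite !tliftE /= linearP.
Qed.

Definition tinter : tens (tens A B) (tens C D) -> tens (tens A C) (tens B D) :=
  tlift tinter_bilin.
HB.instance Definition _ := GRing.Linear.on tinter.

Lemma tinterE a b c d : tinter (tpure (tpure a b) (tpure c d)) =
  tpure (tpure a c) (tpure b d).
Proof. by rewrite /tinter tliftE /= tliftE /= tliftE. Qed.
End Interchange.

End Tensor2.


Section TensorFamily.
Variables (K : fieldType) (I : finType) (V : I -> lmodType K).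

Definition multilin (W : lmodType K) (f : (forall i, V i) -> W) : Prop :=
  forall (v : forall i, V i) (i : I), linear (fun x : V i => f (dfwith v x)).

Definition mtens : lmodType K := umod multilin.

Definition mpure (v : forall i, V i) : mtens := ugen multilin v.

Lemma mtens_multilin : multilin mpure.
Proof.
move=> v i c x y; apply: ulift_inj => W f Pf.
by rewrite linearP /= !ulift_gen; apply: Pf.
Qed.

Definition mlift (W : lmodType K) (f : (forall i, V i) -> W) (mf : multilin f) :
  mtens -> W := ulift (P := multilin) mf.
HB.instance Definition _ (W : lmodType K) (f : (forall i, V i) -> W)
  (mf : multilin f) := GRing.Linear.on (mlift mf).

Lemma mliftE (W : lmodType K) (f : (forall i, V i) -> W) (mf : multilin f) v :
  mlift mf (mpure v) = f v.
Proof. exact: ulift_gen. Qed.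

Lemma mtens_ext (W : lmodType K) (f g : {linear mtens -> W}) :
  (forall v, f (mpure v) = g (mpure v)) -> f =1 g.
Proof. exact: umod_ext. Qed.
End TensorFamily.

(* Direct sum over a finite index type, as the product. *)
Section DirectSum.
Variables (K : fieldType) (I : finType) (V : I -> lmodType K).

Definition dsum := forall i, V i.
HB.instance Definition _ := Choice.on dsum.

Implicit Types x y z : dsum.
Definition dsum_zero : dsum := fun=> 0.
Definition dsum_add x y : dsum := fun i => x i + y i.
Definition dsum_opp x : dsum := fun i => - x i.
Definition dsum_scale (c : K) x : dsum := fun i => c *: x i.

Lemma dsum_addA : associative dsum_add.
Proof. by move=> x y z; apply/functional_extensionality_dep => i; apply: addrA. Qed.
Lemma dsum_addC : commutative dsum_add.
Proof. by move=> x y; apply/functional_extensionality_dep => i; apply: addrC. Qed.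
Lemma dsum_add0 : left_id dsum_zero dsum_add.
Proof. by move=> x; apply/functional_extensionality_dep => i; apply: add0r. Qed.
Lemma dsum_addN : left_inverse dsum_zero dsum_opp dsum_add.
Proof. by move=> x; apply/functional_extensionality_dep => i; apply: addNr. Qed.

HB.instance Definition _ :=
  GRing.isZmodule.Build dsum dsum_addA dsum_addC dsum_add0 dsum_addN.

Lemma dsum_scaleA c d x : dsum_scale c (dsum_scale d x) = dsum_scale (c * d) x.
Proof. by apply/functional_extensionality_dep => i; apply: scalerA. Qed.
Lemma dsum_scale1 : left_id 1 dsum_scale.
Proof. by move=> x; apply/functional_extensionality_dep => i; apply: scale1r. Qed.
Lemma dsum_scaleDr : right_distributive dsum_scale +%R.
Proof. by move=> c x y; apply/functional_extensionality_dep => i; apply: scalerDr. Qed.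
Lemma dsum_scaleDl x : {morph dsum_scale^~ x : c d / c + d}.
Proof. by move=> c d; apply/functional_extensionality_dep => i; apply: scalerDl. Qed.

HB.instance Definition _ := GRing.Zmodule_isLmodule.Build K dsum
  dsum_scaleA dsum_scale1 dsum_scaleDr dsum_scaleDl.

Definition dproj (i : I) (x : dsum) : V i := x i.

Lemma dproj_linear i : linear (dproj i).
Proof. by []. Qed.

HB.instance Definition _ i :=
  GRing.isLinear.Build K dsum (V i) *:%R (dproj i) (dproj_linear i).

Definition dinj (i : I) (v : V i) : dsum := dfwith (fun j => 0 : V j) v.

Lemma dinj_linear i : linear (@dinj i).
Proof.
move=> c u v; apply/functional_extensionality_dep => j.
rewrite {1}/dinj; case: dfwithP => [|k ik].
  by rewrite /dinj -[RHS]/(c *: dfwith _ _ i + dfwith _ _ i) !dfwith_in.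
by rewrite /dinj -[RHS]/(c *: dfwith _ _ k + dfwith _ _ k)
           !dfwith_out // scaler0 addr0.
Qed.

HB.instance Definition _ i :=
  GRing.isLinear.Build K (V i) dsum *:%R (@dinj i) (@dinj_linear i).

Lemma dinj_in i v : dinj v i = v.
Proof. exact: dfwith_in. Qed.

Lemma dinj_out i (v : V i) j : i != j -> dinj v j = 0.
Proof. exact: dfwith_out. Qed.

Lemma dsum_sumE (J : Type) (r : seq J) (P : pred J) (F : J -> dsum) i :
  (\sum_(j <- r | P j) F j) i = \sum_(j <- r | P j) F j i.
Proof. exact: (raddf_sum (dproj i)). Qed.

Lemma dsum_decomp (x : dsum) : x = \sum_i dinj (x i).
Proof.
apply/functional_extensionality_dep => i; rewrite dsum_sumE (bigD1 i) //= dinj_in.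
by rewrite big1 ?addr0 // => j ji; rewrite dinj_out.
Qed.
End DirectSum.

(* The finite sets are the subsets [A : {set T}] of the finite types [T]; all
   finite types occur, as [setT].  Keeping [T] apart from [A] makes the subsets
   of [A] objects in their own right, so that iterated decompositions need no
   transport.  A morphism from [A] to [B] is a bijection between the elements
   of [A] and those of [B], whatever the ambient types. *)
Record fbij (T T' : finType) (A : {set T}) (B : {set T'}) := FBij {
  bfun :> {x : T | x \in A} -> {y : T' | y \in B};
  binv : {y : T' | y \in B} -> {x : T | x \in A};
  bfunK : cancel bfun binv;
  binvK : cancel binv bfun }.

Lemma fbij_ext (T T' : finType) (A : {set T}) (B : {set T'}) (s t : fbij A B) :
  (forall x, sval (s x) = sval (t x)) -> s = t.
Proof.
case: s t => [f f' fK f'K] [g g' gK g'K] /= h.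
have E : f = g by apply: funext => x; apply: val_inj; apply: h.
subst g; have E' : f' = g' by apply: funext => y; rewrite -[y in RHS]f'K gK.
by subst g'; rewrite (Prop_irrelevance fK gK) (Prop_irrelevance f'K g'K).
Qed.

Definition fb_id (T : finType) (A : {set T}) : fbij A A :=
  @FBij _ _ A A id id (fun=> erefl) (fun=> erefl).

Definition fb_sym (T T' : finType) (A : {set T}) (B : {set T'}) (s : fbij A B) :
  fbij B A := FBij (binvK s) (bfunK s).

Definition fb_comp (T T' T'' : finType) (A : {set T}) (B : {set T'})
    (C : {set T''}) (t : fbij B C) (s : fbij A B) : fbij A C :=
  FBij (can_comp (bfunK t) (bfunK s)) (can_comp (binvK s) (binvK t)).

Definition fb_restr (T T' : finType) (A S : {set T}) (B S' : {set T'})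
    (s : fbij A B) (t : fbij S S') : Prop :=
  forall x (xS : x \in S) (xA : x \in A),
    sval (t (exist _ x xS)) = sval (s (exist _ x xA)).

(* [I = S \sqcup R], for the ordered pair [(S, R)] *)
Definition decomp (T : finType) (I S R : {set T}) : bool :=
  (S :|: R == I) && [disjoint S & R].

Section Species.
Variable K : fieldType.

Record species := Species {
  sp : forall T : finType, {set T} -> lmodType K;
  sp_map : forall (T T' : finType) (A : {set T}) (B : {set T'}),
    fbij A B -> {linear sp A -> sp B};
  sp_map_id : forall (T : finType) (A : {set T}) x, sp_map (fb_id A) x = x;
  sp_map_comp : forall (T T' T'' : finType) (A : {set T}) (B : {set T'})
      (C : {set T''}) (t : fbij B C) (s : fbij A B) x,
    sp_map (fb_comp t s) x = sp_map t (sp_map s x) }.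

Record species_mor (p q : species) := SpeciesMor {
  mor :> forall (T : finType) (A : {set T}), {linear sp p A -> sp q A};
  mor_nat : forall (T T' : finType) (A : {set T}) (B : {set T'})
      (s : fbij A B) x,
    mor B (sp_map p s x) = sp_map q s (mor A x) }.

(* Monoid and comonoid structures for the Cauchy product, given by their
   components; the unit species being [K] on every empty set [set0 : {set T}],
   so are [iota] and [eps]. *)
Record monoid_on (p : species) := MonoidOn {
  mu : forall (T : finType) (I S R : {set T}),
    decomp I S R -> {linear tens (sp p S) (sp p R) -> sp p I};
  iota : forall T : finType, {linear K^o -> sp p (set0 : {set T})};
  mu_nat : forall (T T' : finType) (I S R : {set T}) (I' S' R' : {set T'})
      (d : decomp I S R) (d' : decomp I' S' R')
      (s : fbij I I') (t : fbij S S') (r : fbij R R'),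
    fb_restr s t -> fb_restr s r -> forall x,
    sp_map p s (mu d x) = mu d' (tmap (sp_map p t) (sp_map p r) x);
  iota_nat : forall (T T' : finType)
      (s : fbij (set0 : {set T}) (set0 : {set T'})) c,
    sp_map p s (iota T c) = iota T' c;
  mu_assoc : forall (T : finType) (I R S U RS SU : {set T})
      (d1 : decomp I RS U) (d2 : decomp RS R S) (d3 : decomp I R SU) (d4 : decomp SU S U) x,
    mu d1 (tmap (mu d2) idfun x) = mu d3 (tmap idfun (mu d4) (tassoc x));
  mu_unitl : forall (T : finType) (I : {set T}) (d : decomp I set0 I) x,
    mu d (tmap (iota T) idfun x) = tunitl x;
  mu_unitr : forall (T : finType) (I : {set T}) (d : decomp I I set0) x,
    mu d (tmap idfun (iota T) x) = tunitr x }.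

Record comonoid_on (p : species) := ComonoidOn {
  delta : forall (T : finType) (I S R : {set T}),
    decomp I S R -> {linear sp p I -> tens (sp p S) (sp p R)};
  eps : forall T : finType, {linear sp p (set0 : {set T}) -> K^o};
  delta_nat : forall (T T' : finType) (I S R : {set T}) (I' S' R' : {set T'})
      (d : decomp I S R) (d' : decomp I' S' R')
      (s : fbij I I') (t : fbij S S') (r : fbij R R'),
    fb_restr s t -> fb_restr s r -> forall x,
    delta d' (sp_map p s x) = tmap (sp_map p t) (sp_map p r) (delta d x);
  eps_nat : forall (T T' : finType)
      (s : fbij (set0 : {set T}) (set0 : {set T'})) x,
    eps T' (sp_map p s x) = eps T x;
  delta_coassoc : forall (T : finType) (I R S U RS SU : {set T})
      (d1 : decomp I RS U) (d2 : decomp RS R S) (d3 : decomp I R SU) (d4 : decomp SU S U) x,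
    tassoc (tmap (delta d2) idfun (delta d1 x)) =
    tmap idfun (delta d4) (delta d3 x);
  delta_counitl : forall (T : finType) (I : {set T}) (d : decomp I set0 I) x,
    tunitl (tmap (eps T) idfun (delta d x)) = x;
  delta_counitr : forall (T : finType) (I : {set T}) (d : decomp I I set0) x,
    tunitr (tmap idfun (eps T) (delta d x)) = x }.

Record comonoid := Comonoid {
  co_sp :> species;
  co_on :> comonoid_on co_sp }.

(* The four compatibility axioms say that [mu] and [iota] are morphisms of
   comonoids, for the comonoid structures on the Cauchy square and on the unit
   species; in [bi_delta_mu], the sets [A, B, C, D] are necessarily
   [S :&: S', S :&: R', R :&: S', R :&: R']. *)
Record bimonoid := Bimonoid {
  bi_co :> comonoid;
  bi_mon :> monoid_on bi_co;
  bi_delta_mu : forall (T : finType) (I S R S' R' A B C D : {set T})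
      (d : decomp I S R) (d' : decomp I S' R') (dS : decomp S A B) (dR : decomp R C D)
      (dS' : decomp S' A C) (dR' : decomp R' B D) x,
    delta bi_co d' (mu bi_mon d x) =
    tmap (mu bi_mon dS') (mu bi_mon dR')
      (tinter (tmap (delta bi_co dS) (delta bi_co dR) x));
  bi_eps_mu : forall (T : finType) (d : decomp (set0 : {set T}) set0 set0) x,
    eps bi_co T (mu bi_mon d x) = tunitl (tmap (eps bi_co T) (eps bi_co T) x);
  bi_delta_iota : forall (T : finType) (d : decomp (set0 : {set T}) set0 set0) c,
    delta bi_co d (iota bi_mon T c) =
    tmap (iota bi_mon T) (iota bi_mon T) (tpure (c : K^o) (1 : K^o));
  bi_eps_iota : forall (T : finType) (c : K^o),
    eps bi_co T (iota bi_mon T c) = c }.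

Definition cocommutative (c : comonoid) : Prop :=
  forall (T : finType) (I S R : {set T}) (d : decomp I S R) (d' : decomp I R S) x,
    delta c d' x = tswap (delta c d x).

(* [dim p[set0] = 1]: there is a one-element basis. *)
Definition connected (p : species) : Prop :=
  forall T : finType, exists e : sp p (set0 : {set T}),
    forall x, exists! c : K, x = c *: e.

Record comonoid_mor (c d : comonoid) := ComonoidMor {
  cmor :> species_mor c d;
  cmor_delta : forall (T : finType) (I S R : {set T}) (D : decomp I S R) x,
    delta d D (cmor T I x) = tmap (cmor T S) (cmor T R) (delta c D x);
  cmor_eps : forall (T : finType) x, eps d T (cmor T set0 x) = eps c T x }.

Definition is_comonoid_iso (c d : comonoid) (f : comonoid_mor c d) : Prop :=
  exists g : comonoid_mor d c,
    (forall (T : finType) (A : {set T}), cancel (f T A) (g T A)) /\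
    (forall (T : finType) (A : {set T}), cancel (g T A) (f T A)).
End Species.

Arguments sp {K} p {T} A : rename.
Arguments sp_map {K} p {T T' A B} s : rename.

Section Restriction.
Variables (T T' : finType) (A : {set T}) (B : {set T'}) (s : fbij A B).

Definition fb_im (C : {set T}) : {set T'} :=
  [set sval (s x) | x : {x : T | x \in A} & sval x \in C].

Lemma fb_imE C x : (sval (s x) \in fb_im C) = (sval x \in C).
Proof.
apply/imsetP/idP => [[y yC /val_inj E]|xC]; last by exists x; rewrite ?inE.
by rewrite -(bfunK s x) E (bfunK s y); move: yC; rewrite inE.
Qed.

Lemma fb_im_sub C : fb_im C \subset B.
Proof. by apply/subsetP => _ /imsetP[x _ ->]; apply: (svalP (s x)). Qed.

Definition set_incl (U : finType) (C D : {set U}) (CD : C \subset D)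
    (x : {x | x \in C}) : {x | x \in D} :=
  exist _ (sval x) (subsetP CD _ (svalP x)).

Lemma fb_res_subproof (C : {set T}) (CA : C \subset A) (x : {x | x \in C}) :
  sval (s (set_incl CA x)) \in fb_im C.
Proof. by rewrite fb_imE; apply: (svalP x). Qed.

Lemma fb_resV_subproof (C : {set T}) (y : {y | y \in fb_im C}) :
  sval (binv s (set_incl (fb_im_sub C) y)) \in C.
Proof. by rewrite -fb_imE binvK; apply: (svalP y). Qed.

Definition fb_res_fun (C : {set T}) (CA : C \subset A) (x : {x | x \in C}) :
  {y | y \in fb_im C} := exist (fun y => y \in fb_im C) _ (fb_res_subproof CA x).

Definition fb_res_inv (C : {set T}) (y : {y | y \in fb_im C}) : {x | x \in C} :=
  exist (fun x => x \in C) _ (fb_resV_subproof y).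

Lemma fb_resK (C : {set T}) (CA : C \subset A) : cancel (fb_res_fun CA) (@fb_res_inv C).
Proof.
move=> x; apply: val_inj => /=; rewrite -[RHS]/(sval (set_incl CA x)).
by rewrite -(bfunK s (set_incl CA x)); congr (sval (binv s _)); apply: val_inj.
Qed.

Lemma fb_resVK (C : {set T}) (CA : C \subset A) : cancel (@fb_res_inv C) (fb_res_fun CA).
Proof.
move=> y; apply: val_inj => /=; rewrite -[RHS]/(sval (set_incl (fb_im_sub C) y)).
by rewrite -(binvK s (set_incl (fb_im_sub C) y)); congr (sval (s _)); apply: val_inj.
Qed.

Definition fb_res (C : {set T}) (CA : C \subset A) : fbij C (fb_im C) :=
  FBij (fb_resK CA) (fb_resVK CA).

Lemma fb_im_decomp (C D : {set T}) : decomp A C D -> decomp B (fb_im C) (fb_im D).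
Proof.
move=> /andP[/eqP CDA CD]; apply/andP; split.
  rewrite eqEsubset subUset !fb_im_sub /=; apply/subsetP => y yB.
  pose x := binv s (exist _ y yB); have -> : y = sval (s x) by rewrite /x binvK.
  by rewrite in_setU !fb_imE -in_setU CDA (svalP x).
rewrite -setI_eq0; apply/eqP/setP => y; rewrite in_setI in_set0.
apply/negP => /andP[/imsetP[x xC ->]]; rewrite fb_imE => xD.
by move: xC; rewrite inE => /(disjointFr CD); rewrite xD.
Qed.

Lemma fb_im_eq0 (C : {set T}) : C \subset A -> (fb_im C == set0) = (C == set0).
Proof.
move=> CA; apply/eqP/eqP => [E|->]; last first.
  by apply/setP=> y; rewrite in_set0; apply/imsetP => -[x]; rewrite !inE.
apply/setP => x; rewrite in_set0; apply/negP => xC.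
have := fb_imE C (exist _ x (subsetP CA x xC)).
by rewrite E in_set0 /= xC.
Qed.

End Restriction.

Section Primitive.
Variables (K : fieldType) (c : comonoid K).

Section Space.
Variables (T : finType) (I : {set T}).

Definition is_primitive (x : sp c I) : bool :=
  if I == set0 then x == 0 else
  `[< forall (S R : {set T}) (d : decomp I S R),
        S != set0 -> R != set0 -> delta c d x = 0 >].

Lemma is_primitive_submod : submod_closed is_primitive.
Proof.
rewrite /is_primitive; split=> [|k x y]; rewrite !unfold_in /=; case: ifP => _ //.
- by apply/asboolP => S R d _ _; rewrite linear0.
- by move=> /eqP-> /eqP->; rewrite scaler0 addr0.
move=> /asboolP hx /asboolP hy; apply/asboolP => S R d S0 R0.
by rewrite linearP hx // hy // scaler0 addr0.
Qed.

HB.instance Definition _ :=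
  GRing.isSubmodClosed.Build K (sp c I) is_primitive is_primitive_submod.

Record prim := Prim { pval : sp c I; pvalP : is_primitive pval }.

HB.instance Definition _ := [isSub for pval].
HB.instance Definition _ := [Choice of prim by <:].
HB.instance Definition _ := [SubChoice_isSubLmodule of prim by <:].
End Space.

Section Map.
Variables (T T' : finType) (A : {set T}) (B : {set T'}) (s : fbij A B).

Lemma prim_map_subproof (x : prim A) : is_primitive (sp_map c s (pval x)).
Proof.
case: x => u; rewrite /is_primitive /=.
have -> : (B == set0) = (A == set0).
  rewrite -(fb_im_eq0 s (subxx A)); congr (_ == _); apply/eqP.
  rewrite eqEsubset fb_im_sub andbT; apply/subsetP => y yB.
  pose x := binv s (exist _ y yB); have -> : y = sval (s x) by rewrite /x binvK.
  by rewrite fb_imE; apply: (svalP x).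
case: ifP => _; first by move=> /eqP->; rewrite linear0.
move=> /asboolP hx; apply/asboolP => S R d S0 R0.
have [SB RB] : S \subset B /\ R \subset B.
  by case/andP: d => /eqP <- _; rewrite subsetUl subsetUr.
rewrite (@delta_nat _ _ c _ _ _ _ _ _ _ _ (fb_im_decomp (fb_sym s) d) d s
  (fb_sym (fb_res (fb_sym s) SB)) (fb_sym (fb_res (fb_sym s) RB))); last 2 first.
- by move=> z zS zA /=; congr (sval (s _)); apply: val_inj.
- by move=> z zS zA /=; congr (sval (s _)); apply: val_inj.
by rewrite hx ?linear0 // fb_im_eq0.
Qed.

Definition prim_map (x : prim A) : prim B := Prim (prim_map_subproof x).

Lemma prim_map_linear : linear prim_map.
Proof. by move=> k x y; apply: val_inj; rewrite /= linearP. Qed.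

HB.instance Definition _ :=
  GRing.isLinear.Build K (prim A) (prim B) *:%R prim_map prim_map_linear.
End Map.

Lemma prim_map_id (T : finType) (A : {set T}) (x : prim A) :
  prim_map (fb_id A) x = x.
Proof. by apply: val_inj; apply: sp_map_id. Qed.

Lemma prim_map_comp (T T' T'' : finType) (A : {set T}) (B : {set T'})
    (C : {set T''}) (t : fbij B C) (s : fbij A B) x :
  prim_map (fb_comp t s) x = prim_map t (prim_map s x).
Proof. by apply: val_inj; apply: sp_map_comp. Qed.

Definition primitive : species K :=
  @Species K prim (fun _ _ _ _ s => prim_map s) prim_map_id prim_map_comp.
End Primitive.

Section SetPartitions.
Variable T : finType.
Implicit Types (X : {set {set T}}) (B I S R U : {set T}).

Definition parts I := {X : {set {set T}} | partition X I}.

Definition compat X S R : bool := [forall B in X, (B \subset S) || (B \subset R)].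

Definition part_in X S : {set {set T}} := [set B in X | B \subset S].

Lemma part_in_sub X S : part_in X S \subset X.
Proof. by apply/subsetP => B; rewrite inE => /andP[]. Qed.

Lemma decompC I S R : decomp I S R = decomp I R S.
Proof. by rewrite /decomp setUC disjoint_sym. Qed.

Lemma decomp_subl I S R : decomp I S R -> S \subset I.
Proof. by case/andP => /eqP <- _; apply: subsetUl. Qed.

Lemma decomp_subr I S R : decomp I S R -> R \subset I.
Proof. by case/andP => /eqP <- _; apply: subsetUr. Qed.

Lemma compatC X S R : compat X S R = compat X R S.
Proof. by apply: eq_forallb => B; rewrite orbC. Qed.

Lemma decomp_sub2 I S R B : decomp I S R -> B \subset S -> B \subset R -> B = set0.
Proof.
case/andP=> _ SR BS BR; apply/eqP; rewrite -subset0.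
by rewrite -(disjoint_setI0 SR) subsetI BS.
Qed.

Lemma part_block_sub X I B : partition X I -> B \in X -> B \subset I.
Proof. by case/and3P => /eqP <- _ _ BX; apply: bigcup_sup. Qed.

Lemma part_block_neq0 X I B : partition X I -> B \in X -> B != set0.
Proof. by case/and3P => _ _ X0 BX; apply: contraNneq X0 => <-. Qed.

Lemma part_in_partition X I S R : partition X I -> decomp I S R -> compat X S R ->
  partition (part_in X S) S.
Proof.
move=> PX d /forallP hc; have [/eqP cX tX X0] := and3P PX.
apply/and3P; split; last by rewrite inE (negPf X0).
  rewrite eqEsubset; apply/andP; split.
    by apply/bigcupsP => B; rewrite inE => /andP[].
  apply/subsetP => x xS; have : x \in cover X.
    by rewrite cX (subsetP (decomp_subl d)).
  case/bigcupP => B BX xB; apply/bigcupP; exists B => //; rewrite inE BX /=.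
  have := hc B; rewrite BX /= => /orP[//|/subsetP BR].
  by case/andP: d => _ /disjointFr/(_ xS); rewrite BR.
exact: (trivIsetS (part_in_sub X S)).
Qed.

Lemma part_in_in X S S' : S \subset S' -> part_in (part_in X S') S = part_in X S.
Proof.
move=> SS'; apply/setP => B; rewrite !inE -andbA.
by case: (boolP (B \subset S)) => [/subset_trans->//|]; rewrite ?andbF.
Qed.

Lemma compat_assoc X I R S U RS SU : partition X I ->
  decomp I RS U -> decomp RS R S -> decomp I R SU -> decomp SU S U ->
  compat X RS U && compat (part_in X RS) R S =
  compat X R SU && compat (part_in X SU) S U.
Proof.
move=> PX d1 d2 d3 d4.
have E : forall Y Z, compat X Y Z <-> forall B, B \in X -> B \subset Y \/ B \subset Z.
  move=> Y Z; split => [/forallP h B BX|h].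
    by have := h B; rewrite BX /= => /orP.
  by apply/forallP => B; apply/implyP => BX; apply/orP; apply: h.
have E' : forall V Y Z, compat (part_in X V) Y Z <->
    forall B, B \in X -> B \subset V -> B \subset Y \/ B \subset Z.
  move=> V Y Z; split => [/forallP h B BX BV|h].
    by have := h B; rewrite inE BX BV /= => /orP.
  apply/forallP => B; apply/implyP; rewrite inE => /andP[BX BV].
  by apply/orP; apply: h.
apply/idP/idP => /andP[/E h1 /E' h2]; apply/andP; split.
- apply/E => B BX; case: (h1 B BX) => [BRS|BU].
    case: (h2 B BX BRS) => ?; [by left|right].
    by apply: subset_trans (decomp_subl d4).
  by right; apply: subset_trans (decomp_subr d4).
- apply/E' => B BX BSU; case: (h1 B BX) => [BRS|BU]; last by right.
  case: (h2 B BX BRS) => [BR|]; [|by left].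
  by rewrite (decomp_sub2 d3 BR BSU) !sub0set; left.
- apply/E => B BX; case: (h1 B BX) => [BR|BSU].
    by left; apply: subset_trans (decomp_subl d2).
  case: (h2 B BX BSU) => ?; [left|by right].
  by apply: subset_trans (decomp_subr d2).
- apply/E' => B BX BRS; case: (h1 B BX) => [|BSU]; first by left.
  case: (h2 B BX BSU) => [|BU]; [by right|].
  by rewrite (decomp_sub2 d1 BRS BU) !sub0set; left.
Qed.
End SetPartitions.

Section BijectionImages.
Variables (T T' : finType).

Lemma fb_imK (A : {set T}) (B : {set T'}) (s : fbij A B) (C : {set T}) :
  C \subset A -> fb_im (fb_sym s) (fb_im s C) = C.
Proof.
move=> CA; apply/setP => x; apply/imsetP/idP => [[y]|xC].
  rewrite inE -[y](binvK s) fb_imE => h -> /=.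
  by rewrite bfunK.
exists (s (exist _ x (subsetP CA x xC))); first by rewrite inE fb_imE.
by rewrite /= bfunK.
Qed.

Lemma fb_imS (A : {set T}) (B : {set T'}) (s : fbij A B) (C D : {set T}) :
  C \subset A -> (fb_im s C \subset fb_im s D) = (C \subset D).
Proof.
move=> CA; apply/idP/idP => /subsetP h; apply/subsetP => x.
  move=> xC; have := h (sval (s (exist _ x (subsetP CA x xC)))).
  by rewrite !fb_imE; apply.
case/imsetP => y; rewrite inE => yC ->; rewrite fb_imE; exact: h.
Qed.

Lemma fb_im_full (A : {set T}) (B : {set T'}) (s : fbij A B) : fb_im s A = B.
Proof.
apply/eqP; rewrite eqEsubset fb_im_sub; apply/subsetP => y yB.
pose x := binv s (exist _ y yB); have -> : y = sval (s x) by rewrite /x binvK.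
by rewrite fb_imE; apply: (svalP x).
Qed.

Lemma fb_im_restr (A S : {set T}) (B S' : {set T'}) (s : fbij A B)
    (t : fbij S S') (C : {set T}) :
  S \subset A -> fb_restr s t -> C \subset S -> fb_im t C = fb_im s C.
Proof.
move=> SA st CS; apply/setP => y; apply/imsetP/imsetP => -[[x xS]].
  rewrite inE /= => xC ->; exists (exist _ x (subsetP SA x xS)); first by rewrite inE.
  exact: st.
rewrite inE /= => xC ->.
exists (exist _ x (subsetP CS x xC)); first by rewrite inE.
by rewrite (st _ _ xS).
Qed.

Lemma fb_restr_uniq (A S : {set T}) (B S' : {set T'}) (s : fbij A B)
    (t u : fbij S S') : S \subset A -> fb_restr s t -> fb_restr s u -> t = u.
Proof.
move=> SA h1 h2; apply: fbij_ext => -[x xS].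
by rewrite (h1 x xS (subsetP SA x xS)) (h2 x xS (subsetP SA x xS)).
Qed.

Lemma fb_res_restr (A : {set T}) (B : {set T'}) (s : fbij A B) (C : {set T})
    (CA : C \subset A) : fb_restr s (fb_res s CA).
Proof. by move=> x xC xA /=; congr (sval (s _)); apply: val_inj. Qed.

Lemma fb_sym_restr (A S : {set T}) (B S' : {set T'}) (s : fbij A B)
    (t : fbij S S') : S \subset A ->
  fb_restr s t -> fb_restr (fb_sym s) (fb_sym t).
Proof.
move=> SA st y yS yB /=.
set x := binv t _; have xA : sval x \in A by apply: (subsetP SA); apply: (svalP x).
have := st (sval x) (svalP x) xA.
have -> : exist _ (sval x) (svalP x) = x by apply: val_inj.
rewrite /x binvK /= => E.
have -> : exist _ y yB = s (exist _ (sval x) xA) by apply: val_inj.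
by rewrite bfunK.
Qed.

Definition fb_ims (A : {set T}) (B : {set T'}) (s : fbij A B)
  (X : {set {set T}}) : {set {set T'}} := [set fb_im s C | C in X].

Lemma fb_ims_partition (A : {set T}) (B : {set T'}) (s : fbij A B)
    (X : {set {set T}}) : partition X A -> partition (fb_ims s X) B.
Proof.
move=> PX; have [/eqP cX /trivIsetP tX X0] := and3P PX.
apply/and3P; split.
- rewrite eqEsubset; apply/andP; split.
    by apply/bigcupsP => _ /imsetP[C _ ->]; apply: fb_im_sub.
  apply/subsetP => y yB; pose x := binv s (exist _ y yB).
  have -> : y = sval (s x) by rewrite /x binvK.
  have : sval x \in cover X by rewrite cX; apply: (svalP x).
  case/bigcupP => C CX xC.
  by apply/bigcupP; exists (fb_im s C); [apply: imset_f|rewrite fb_imE].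
- apply/trivIsetP => _ _ /imsetP[C CX ->] /imsetP[D DX ->] CD.
  have {}CD : C != D by apply: contraNneq CD => ->.
  rewrite -setI_eq0; apply/eqP/setP => y; rewrite in_setI in_set0.
  apply/negP => /andP[/imsetP[x xC ->]]; rewrite fb_imE => xD.
  by move: xC; rewrite inE => /(disjointFr (tX _ _ CX DX CD)); rewrite xD.
- apply/imsetP => -[C CX /esym/eqP].
  by rewrite fb_im_eq0 ?(part_block_sub PX) // (negPf (part_block_neq0 PX CX)).
Qed.
End BijectionImages.

(* S(q), for an arbitrary species [q]: as blocks are nonempty, only the part of
   [q] on nonempty sets matters. *)
Section SymSpecies.
Variables (K : fieldType) (q : species K).

Section Space.
Variable T : finType.
Implicit Types (X Y : {set {set T}}).

Definition fam X := forall B : {B : {set T} | B \in X}, sp q (sval B).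

(* [q(X)]: a tensor product indexed by the blocks of [X] themselves, without any
   chosen order on them *)
Definition qten X : lmodType K :=
  mtens (fun B : {B : {set T} | B \in X} => sp q (sval B)).

Definition sym_sp (I : {set T}) : lmodType K :=
  dsum (fun X : parts I => qten (sval X)).

Definition fam_res X Y (YX : Y \subset X) (x : fam X) : fam Y :=
  fun B => x (set_incl YX B).
Lemma fam_irr X (x : fam X) (B : {set T}) (h h' : B \in X) :
  x (exist _ B h) = x (exist _ B h').
Proof. by rewrite (bool_irrelevance h h'). Qed.
End Space.

Section Map.
Variables (T T' : finType) (A : {set T}) (B : {set T'}) (s : fbij A B).

(* The component of [sym_map s z] at [Y] is computed from that of [z] at
   [s^-1(Y)], the factor [C \in Y] being the image of the factor [s^-1(C)]. *)
Definition part_pull (Y : parts B) : parts A :=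
  exist (fun X => partition X A) _ (fb_ims_partition (fb_sym s) (svalP Y)).

Section Component.
Variable Y : parts B.

Definition block_pull (C : {C | C \in sval Y}) : {C | C \in sval (part_pull Y)} :=
  exist (fun C => C \in sval (part_pull Y)) _
    (imset_f (fb_im (fb_sym s)) (svalP C)).

Definition block_bij (C : {C | C \in sval Y}) :
    fbij (sval (block_pull C)) (sval C) :=
  fb_sym (fb_res (fb_sym s) (part_block_sub (svalP Y) (svalP C))).

Definition fam_push (x : fam (sval (part_pull Y))) : fam (sval Y) :=
  fun C => sp_map q (block_bij C) (x (block_pull C)).

Lemma block_pull_inj : injective block_pull.
Proof.
move=> C D /(congr1 sval) /= E; apply: val_inj => /=.
by rewrite -[LHS](fb_imK (fb_sym s) (part_block_sub (svalP Y) (svalP C))) E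
           fb_imK // (part_block_sub (svalP Y) (svalP D)).
Qed.

Lemma block_pull_surj D : exists C, block_pull C = D.
Proof.
have /imsetP[C CY E] := svalP D.
by exists (exist _ C CY); apply: val_inj.
Qed.

Lemma fam_push_multilin : multilin (fun x => mpure (fam_push x)).
Proof.
move=> v D; have [C <-] := block_pull_surj D => c x y.
have E z : fam_push (dfwith v z) =
    dfwith (fam_push v) (sp_map q (block_bij C) z).
  apply/functional_extensionality_dep => C'; rewrite /fam_push.
  case: (dfwithP (fam_push v) (sp_map q (block_bij C) z) C') => [|C'' CC''].
    by rewrite dfwith_in.
  by rewrite dfwith_out // (inj_eq block_pull_inj).
by rewrite !E linearP mtens_multilin.
Qed.

Definition qten_map : qten (sval (part_pull Y)) -> qten (sval Y) :=
  mlift fam_push_multilin.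
HB.instance Definition _ := GRing.Linear.on qten_map.
End Component.

Definition sym_map (z : sym_sp A) : sym_sp B :=
  fun Y => @qten_map Y (z (part_pull Y)).

Lemma sym_map_linear : linear sym_map.
Proof.
move=> c x y; apply/functional_extensionality_dep => Y.
exact: (linearP (@qten_map Y)).
Qed.

HB.instance Definition _ :=
  GRing.isLinear.Build K (sym_sp A) (sym_sp B) *:%R sym_map sym_map_linear.
End Map.

Definition sgen (T : finType) (I : {set T}) (X : parts I) (x : fam (sval X)) :
  sym_sp I := dinj (mpure x).

Lemma sgen_eq (T : finType) (I : {set T}) (X Y : parts I)
    (x : fam (sval X)) (y : fam (sval Y)) : sval X = sval Y ->
  (forall B (BX : B \in sval X) (BY : B \in sval Y),
     x (exist _ B BX) = y (exist _ B BY)) ->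
  sgen x = sgen y.
Proof.
move=> /val_inj E; subst Y => h; congr (sgen _).
by apply/functional_extensionality_dep => -[B BX]; apply: h.
Qed.

Lemma sym_ext (T : finType) (I : {set T}) (W : lmodType K)
    (f g : {linear sym_sp I -> W}) :
  (forall (X : parts I) (x : fam (sval X)), f (sgen x) = g (sgen x)) -> f =1 g.
Proof.
move=> h z; rewrite [z]dsum_decomp !raddf_sum; apply: eq_bigr => X _.
exact: (@mtens_ext _ _ _ _ (f \o @dinj _ _ _ X) (g \o @dinj _ _ _ X) (h X)).
Qed.

Lemma sym_map_gen (T T' : finType) (A : {set T}) (B : {set T'}) (s : fbij A B)
    (X : parts A) (Y : parts B) (x : fam (sval X)) (y : fam (sval Y)) :
  sval Y = fb_ims s (sval X) ->
  (forall (C : {C | C \in sval X}) (D : {D | D \in sval Y})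
      (t : fbij (sval C) (sval D)),
     fb_restr s t -> y D = sp_map q t (x C)) ->
  sym_map s (sgen x) = sgen y.
Proof.
move=> EY h.
have EX : X = part_pull s Y.
  apply: val_inj => /=; rewrite EY; apply/setP => C.
  apply/idP/imsetP => [CX|[_ /imsetP[D DX ->] ->]].
    exists (fb_im s C); first exact: imset_f.
    by rewrite fb_imK // (part_block_sub (svalP X)).
  by rewrite fb_imK // (part_block_sub (svalP X)).
subst X; apply/functional_extensionality_dep => Z; rewrite /sym_map /sgen.
have [<-|YZ] := eqVneq Y Z.
  rewrite !dinj_in /qten_map mliftE; congr mpure.
  apply/functional_extensionality_dep => D; rewrite /fam_push.
  apply/esym/h => u uC uA /=; congr (sval (s _)); exact: val_inj.
rewrite !dinj_out ?linear0 //; apply: contraNneq YZ => /(congr1 sval) /= E.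
apply/eqP/val_inj/setP => /= D.
have H (U V : parts B) : fb_ims (fb_sym s) (sval U) = fb_ims (fb_sym s) (sval V) ->
    D \in sval U -> D \in sval V.
  move=> {}E DU; have : fb_im (fb_sym s) D \in fb_ims (fb_sym s) (sval V).
    by rewrite -E imset_f.
  case/imsetP => D' D'V ED.
  rewrite -(fb_imK (fb_sym s) (part_block_sub (svalP U) DU)) ED.
  by rewrite fb_imK // (part_block_sub (svalP V)).
by apply/idP/idP; apply: H.
Qed.

Lemma sym_map_push (T T' : finType) (A : {set T}) (B : {set T'}) (s : fbij A B)
    (X : parts A) (x : fam (sval X)) :
  exists (Y : parts B) (y : fam (sval Y)), sval Y = fb_ims s (sval X) /\
  (forall (C : {C | C \in sval X}) (D : {D | D \in sval Y})
      (t : fbij (sval C) (sval D)),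
     fb_restr s t -> y D = sp_map q t (x C)).
Proof.
pose Y : parts B :=
  exist (fun Y => partition Y B) _ (fb_ims_partition s (svalP X)).
have EX : X = part_pull s Y.
  apply: val_inj => /=; apply/setP => C.
  apply/idP/imsetP => [CX|[_ /imsetP[D DX ->] ->]].
    exists (fb_im s C); first exact: imset_f.
    by rewrite fb_imK // (part_block_sub (svalP X)).
  by rewrite fb_imK // (part_block_sub (svalP X)).
have EY : sval Y = fb_ims s (sval X) by [].
move: Y EX EY => Y EX EY; subst X.
exists Y, (fam_push x); split=> // C D t st.
have CA := part_block_sub (svalP (part_pull s Y)) (svalP C).
have E : C = block_pull s D.
  apply: val_inj => /=.
  have -> : sval D = fb_im s (sval C) by rewrite -(fb_im_restr CA st) // fb_im_full.
  by rewrite fb_imK.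
subst C; rewrite /fam_push; congr (sp_map q _ _).
apply: fb_restr_uniq st => // u uC uA /=; congr (sval (s _)); exact: val_inj.
Qed.

Lemma sym_map_id (T : finType) (A : {set T}) (z : sym_sp A) :
  sym_map (fb_id A) z = z.
Proof.
apply: (sym_ext (f := @sym_map _ _ _ _ (fb_id A)) (g := idfun)) => X x /=.
have im_id (C : {set T}) : C \subset A -> fb_im (fb_id A) C = C.
  move=> CA; apply/setP => u; apply/imsetP/idP => [[v]|uC].
    by rewrite inE => ? ->.
  by exists (exist _ u (subsetP CA u uC)); rewrite ?inE.
apply: sym_map_gen.
  apply/setP => C; apply/idP/imsetP => [CX|[D DX ->]].
    by exists C; rewrite ?im_id // (part_block_sub (svalP X)).
  by rewrite im_id // (part_block_sub (svalP X)).
move=> C D t st; have CA := part_block_sub (svalP X) (svalP C).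
have E : sval D = sval C.
  by rewrite -(fb_im_full t) (fb_im_restr CA st) // im_id.
move/val_inj in E; subst D; rewrite -[LHS]sp_map_id.
by congr (sp_map q _ _); apply: fbij_ext => -[u uC]; rewrite (st u uC (subsetP CA u uC)).
Qed.

Lemma sym_map_comp (T T' T'' : finType) (A : {set T}) (B : {set T'})
    (C : {set T''}) (t : fbij B C) (s : fbij A B) (z : sym_sp A) :
  sym_map (fb_comp t s) z = sym_map t (sym_map s z).
Proof.
apply: (sym_ext (f := @sym_map _ _ _ _ (fb_comp t s))
                (g := @sym_map _ _ _ _ t \o @sym_map _ _ _ _ s)) => X x /=.
have [Y [y [EY hy]]] := sym_map_push s x; rewrite (sym_map_gen EY hy).
have [Z [w [EZ hw]]] := sym_map_push t y; rewrite (sym_map_gen EZ hw).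
have im_comp (D : {set T}) : D \subset A ->
    fb_im (fb_comp t s) D = fb_im t (fb_im s D).
  move=> DA; apply/setP => u; apply/imsetP/imsetP => -[v]; rewrite inE.
    by move=> vD ->; exists (s v); rewrite ?inE ?fb_imE.
  rewrite -[v](binvK s) fb_imE => vD ->; exists (binv s v); rewrite ?inE //=.
apply: sym_map_gen.
  rewrite EZ EY; apply/setP => D; apply/imsetP/imsetP.
    case=> _ /imsetP[E EX ->] ->; exists E => //.
    by rewrite im_comp // (part_block_sub (svalP X)).
  case=> E EX ->; exists (fb_im s E); first exact: imset_f.
  by rewrite im_comp // (part_block_sub (svalP X)).
move=> D F u su; have DA := part_block_sub (svalP X) (svalP D).
have EF : sval F = fb_im t (fb_im s (sval D)).
  by rewrite -im_comp // -(fb_im_restr DA su) // fb_im_full.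
have EinY : fb_im s (sval D) \in sval Y by rewrite EY imset_f // (svalP D).
pose E : {E | E \in sval Y} := exist (fun E => E \in sval Y) _ EinY.
have sE := fb_im_sub s (sval D).
have FinZ : fb_im t (fb_im s (sval D)) \in sval Z by rewrite -EF; apply: (svalP F).
have EF' : F = exist (fun F => F \in sval Z) _ FinZ by apply: val_inj.
subst F.
rewrite (hw E (exist (fun F => F \in sval Z) _ FinZ) (fb_res t sE)); last exact: fb_res_restr.
rewrite (hy D E (fb_res s DA : fbij _ (sval E))); last exact: fb_res_restr.
rewrite -sp_map_comp; congr (sp_map q _ _).
apply: (fb_restr_uniq DA) su => v vD vA /=.
by congr (sval (t _)); apply: val_inj => /=; congr (sval (s _)); apply: val_inj.
Qed.

Definition sym_species : species K :=
  @Species K sym_sp (fun _ _ _ _ s => sym_map s) sym_map_id sym_map_comp.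

Section Coproduct.
Variables (T : finType) (I S R : {set T}) (d : decomp I S R).

Section Component.
Variables (X : parts I) (hc : compat (sval X) S R).

Definition part_l : parts S := exist (fun Y => partition Y S)
  (part_in (sval X) S) (part_in_partition (svalP X) d hc).

Lemma part_r_subproof : partition (part_in (sval X) R) R.
Proof.
by apply: (part_in_partition (svalP X)); [rewrite decompC; apply: d|rewrite compatC].
Qed.

Definition part_r : parts R := exist (fun Y => partition Y R)
  (part_in (sval X) R) part_r_subproof.

Definition fam_split (x : fam (sval X)) : tens (sym_sp S) (sym_sp R) :=
  tpure (dinj (i := part_l) (mpure (fam_res (part_in_sub (sval X) S) x)))
        (dinj (i := part_r) (mpure (fam_res (part_in_sub (sval X) R) x))).

Lemma fam_res_in (U : {set T}) (v : fam (sval X)) (B : {B | B \in sval X})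
    (BU : sval B \in part_in (sval X) U) z :
  fam_res (part_in_sub (sval X) U) (dfwith v z) =
  dfwith (fam_res (part_in_sub (sval X) U) v)
    (i := exist (fun B => B \in part_in (sval X) U) (sval B) BU) z.
Proof.
apply/functional_extensionality_dep => C; rewrite /fam_res.
case: B BU z => B BX /= BU z.
have [<-|BC] := eqVneq (exist (fun B => B \in part_in (sval X) U) B BU) C.
  rewrite dfwith_in /set_incl; move: (subsetP _ _ _) => /= p.
  by rewrite (bool_irrelevance BX p) dfwith_in.
by rewrite !dfwith_out.
Qed.

Lemma fam_res_out (U : {set T}) (v : fam (sval X)) (B : {B | B \in sval X})
    (BU : sval B \notin part_in (sval X) U) z :
  fam_res (part_in_sub (sval X) U) (dfwith v (i := B) z) =
  fam_res (part_in_sub (sval X) U) v.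
Proof.
apply/functional_extensionality_dep => C; rewrite /fam_res dfwith_out //.
apply: contraNneq BU => ->; exact: (svalP C).
Qed.

Lemma fam_split_multilin : multilin fam_split.
Proof.
move=> v B c x y; rewrite /fam_split.
have BX := svalP B; have B0 := part_block_neq0 (svalP X) BX.
have [BS|BS] := boolP (sval B \subset S).
  have BSin : sval B \in part_in (sval X) S by rewrite inE BX.
  have BRout : sval B \notin part_in (sval X) R.
    rewrite inE BX /=; apply: contraNN B0 => BR.
    by rewrite (decomp_sub2 d BS BR).
  by rewrite !(fam_res_in _ BSin) !(fam_res_out _ BRout) mtens_multilin
             linearP tpurePl.
have BSout : sval B \notin part_in (sval X) S by rewrite inE BX.
have BRin : sval B \in part_in (sval X) R.
  by rewrite inE BX; move/forallP/(_ (sval B)): hc; rewrite BX (negPf BS).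
by rewrite !(fam_res_in _ BRin) !(fam_res_out _ BSout) mtens_multilin
           linearP tpurePr.
Qed.

Definition qten_delta : qten (sval X) -> tens (sym_sp S) (sym_sp R) :=
  mlift fam_split_multilin.
HB.instance Definition _ := GRing.Linear.on qten_delta.
End Component.

Definition sym_delta (z : sym_sp I) : tens (sym_sp S) (sym_sp R) :=
  \sum_(X : parts I)
    (if @idP (compat (sval X) S R) is ReflectT hc then qten_delta hc (z X) else 0).

Lemma sym_delta_linear : linear sym_delta.
Proof.
move=> c x y; rewrite /sym_delta scaler_sumr -big_split /=; apply: eq_bigr => X _.
case: {-}_ / idP => [hc|_]; last by rewrite scaler0 addr0.
exact: (linearP (qten_delta hc)).
Qed.

HB.instance Definition _ := GRing.isLinear.Build K (sym_sp I)
  (tens (sym_sp S) (sym_sp R)) *:%R sym_delta sym_delta_linear.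

Lemma sym_delta_gen (X : parts I) (x : fam (sval X)) (hc : compat (sval X) S R) :
  sym_delta (sgen x) =
  tpure (sgen (X := part_l hc) (fam_res (part_in_sub (sval X) S) x))
        (sgen (X := part_r hc) (fam_res (part_in_sub (sval X) R) x)).
Proof.
rewrite /sym_delta (bigD1 X) //= big1 ?addr0 => [|Y YX].
  case: {-}_ / idP => [hc'|//]; rewrite /sgen dinj_in /qten_delta mliftE.
  by rewrite (bool_irrelevance hc' hc).
case: {-}_ / idP => [hc'|//]; rewrite /sgen dinj_out ?linear0 //.
by rewrite eq_sym.
Qed.

Lemma sym_delta_gen0 (X : parts I) (x : fam (sval X)) :
  ~~ compat (sval X) S R -> sym_delta (sgen x) = 0.
Proof.
move=> nc; rewrite /sym_delta big1 // => Y _.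
case: {-}_ / idP => [hc'|//]; rewrite /sgen dinj_out ?linear0 //.
by apply: contraNneq nc => ->.
Qed.
End Coproduct.

Section Counit.
Variable T : finType.

Lemma part0_subproof : partition (set0 : {set {set T}}) set0.
Proof. by rewrite partition_set0. Qed.

Definition part0 : parts (set0 : {set T}) :=
  exist (fun X => partition X set0) set0 part0_subproof.

Lemma qten0_multilin : @multilin K _
  (fun B : {B : {set T} | B \in set0} => sp q (sval B)) K^o (fun=> 1).
Proof. by move=> v B; have := svalP B; rewrite in_set0. Qed.

(* the identification of the empty tensor product with [K] *)
Definition qten0 : qten (set0 : {set {set T}}) -> K^o :=
  mlift qten0_multilin.
HB.instance Definition _ := GRing.Linear.on qten0.

Definition sym_eps (z : sym_sp (set0 : {set T})) : K^o := qten0 (z part0).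

Lemma sym_eps_linear : linear sym_eps.
Proof. by move=> c x y; apply: (linearP qten0). Qed.

HB.instance Definition _ := GRing.isLinear.Build K (sym_sp (set0 : {set T}))
  K^o *:%R sym_eps sym_eps_linear.

Lemma sym_eps_gen (X : parts (set0 : {set T})) (x : fam (sval X)) :
  sym_eps (sgen x) = 1.
Proof.
have E : X = part0.
  by apply: val_inj => /=; apply/eqP; rewrite -partition_set0; apply: (svalP X).
by subst X; rewrite /sym_eps /sgen dinj_in /qten0 mliftE.
Qed.
End Counit.

Lemma sym_delta_nat (T T' : finType) (I S R : {set T}) (I' S' R' : {set T'})
    (d : decomp I S R) (d' : decomp I' S' R')
    (s : fbij I I') (t : fbij S S') (r : fbij R R') :
  fb_restr s t -> fb_restr s r -> forall z : sym_sp I,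
  sym_delta d' (sym_map s z) =
  tmap (@sym_map _ _ _ _ t) (@sym_map _ _ _ _ r) (sym_delta d z).
Proof.
move=> st sr z.
apply: (sym_ext (f := @sym_delta _ _ _ _ d' \o @sym_map _ _ _ _ s)
  (g := tmap (@sym_map _ _ _ _ t) (@sym_map _ _ _ _ r) \o
        @sym_delta _ _ _ _ d)) => X x /=.
have [Y [y [EY hy]]] := sym_map_push s x; rewrite (sym_map_gen EY hy).
have SI := decomp_subl d; have RI := decomp_subr d.
have imS : fb_im s S = S' by rewrite -(fb_im_restr SI st) // fb_im_full.
have imR : fb_im s R = R' by rewrite -(fb_im_restr RI sr) // fb_im_full.
have ims_in (U : {set T}) (U' : {set T'}) (u : fbij U U') : U \subset I ->
    fb_restr s u ->
    part_in (sval Y) U' = fb_ims u (part_in (sval X) U).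
  move=> UI su; have imU : fb_im s U = U'.
    by rewrite -(fb_im_restr UI su) // fb_im_full.
  have sub B : B \in sval X -> (fb_im s B \subset U') = (B \subset U).
    by move=> BX; rewrite -imU fb_imS // (part_block_sub (svalP X)).
  apply/setP => C; rewrite inE EY; apply/andP/imsetP.
    case=> /imsetP[B BX ->]; rewrite sub // => BU.
    by exists B; rewrite ?inE ?BX // (fb_im_restr UI su).
  case=> B; rewrite inE => /andP[BX BU] ->; rewrite (fb_im_restr UI su) //.
  by rewrite imset_f // sub.
have Ec : compat (sval Y) S' R' = compat (sval X) S R.
  rewrite -imS -imR EY; apply/forallP/forallP => h B; apply/implyP.
    move=> BX; have := h (fb_im s B); rewrite imset_f //= !fb_imS //;
    exact: (part_block_sub (svalP X)).
  case/imsetP => C CX ->; have := h C; rewrite CX /=.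
  by rewrite !fb_imS // (part_block_sub (svalP X)).
have [hc|nc] := boolP (compat (sval X) S R); last first.
  by rewrite !sym_delta_gen0 ?Ec // linear0.
have hc' : compat (sval Y) S' R' by rewrite Ec.
rewrite (sym_delta_gen _ _ hc) (sym_delta_gen _ _ hc') tmapE /=.
have restr_tr (U : {set T}) (U' : {set T'}) (u : fbij U U')
    (C : {set T}) (D : {set T'}) (w : fbij C D) : C \subset U -> U \subset I ->
    fb_restr s u -> fb_restr u w -> fb_restr s w.
  move=> CU UI su uw v vC vI; rewrite (uw v vC (subsetP CU v vC)).
  exact: su.
congr tpure; apply/esym/sym_map_gen.
- exact: ims_in.
- move=> C D w tw; apply: (hy (set_incl (part_in_sub _ S) C) (set_incl (part_in_sub _ S') D) w).
  apply: restr_tr SI st tw.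
  exact: (part_block_sub (svalP (part_l d hc)) (svalP C)).
- exact: ims_in.
- move=> C D w tw; apply: (hy (set_incl (part_in_sub _ R) C) (set_incl (part_in_sub _ R') D) w).
  apply: restr_tr RI sr tw.
  exact: (part_block_sub (svalP (part_r d hc)) (svalP C)).
Qed.

Lemma sym_eps_nat (T T' : finType)
    (s : fbij (set0 : {set T}) (set0 : {set T'})) (z : sym_sp set0) :
  sym_eps (sym_map s z) = sym_eps z.
Proof.
apply: (sym_ext (f := @sym_eps T' \o @sym_map _ _ _ _ s)
                (g := @sym_eps T)) => X x /=.
by have [Y [y [EY hy]]] := sym_map_push s x; rewrite (sym_map_gen EY hy) !sym_eps_gen.
Qed.

Lemma sym_delta_coassoc (T : finType) (I R S U RS SU : {set T})
    (d1 : decomp I RS U) (d2 : decomp RS R S) (d3 : decomp I R SU) (d4 : decomp SU S U)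
    (z : sym_sp I) :
  tassoc (tmap (@sym_delta _ _ _ _ d2) idfun (sym_delta d1 z)) =
  tmap idfun (@sym_delta _ _ _ _ d4) (sym_delta d3 z).
Proof.
apply: (sym_ext
  (f := @tassoc K _ _ _ \o (tmap (@sym_delta _ _ _ _ d2) idfun \o
        @sym_delta _ _ _ _ d1))
  (g := tmap idfun (@sym_delta _ _ _ _ d4) \o @sym_delta _ _ _ _ d3)) => X x /=.
have Ec := compat_assoc (svalP X) d1 d2 d3 d4.
have [hc1|nc1] := boolP (compat (sval X) RS U && compat (part_in (sval X) RS) R S).
  have := hc1; rewrite Ec => /andP[c3 c4]; have /andP[c1 c2] := hc1.
  rewrite (sym_delta_gen _ _ c1) tmapE /=.
  rewrite (sym_delta_gen (X := part_l d1 c1) _ _ c2) tassocE.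
  rewrite (sym_delta_gen _ _ c3) tmapE /=.
  rewrite (sym_delta_gen (X := part_r d3 c3) _ _ c4).
  have RRS := decomp_subl d2; have SRS := decomp_subr d2.
  have SSU := decomp_subl d4; have USU := decomp_subr d4.
  congr tpure; last congr tpure; apply: sgen_eq => /=;
    try (by rewrite ?part_in_in); by move=> B B1 B2; exact: (fam_irr x (B := B)).
have L : tmap (@sym_delta _ _ _ _ d2) idfun (sym_delta d1 (sgen x)) = 0.
  have [c1|c1] := boolP (compat (sval X) RS U); last by rewrite sym_delta_gen0 ?linear0.
  rewrite (sym_delta_gen _ _ c1) tmapE /= sym_delta_gen0 ?tpure0l //.
  by move: nc1; rewrite c1.
rewrite L linear0; rewrite Ec in nc1.
have [c1|c1] := boolP (compat (sval X) R SU); last by rewrite sym_delta_gen0 ?linear0.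
rewrite (sym_delta_gen _ _ c1) tmapE /= [sym_delta d4 _]sym_delta_gen0 ?tpure0r //.
by move: nc1; rewrite c1.
Qed.

Lemma sym_delta_counitl (T : finType) (I : {set T}) (d : decomp I set0 I)
    (z : sym_sp I) :
  tunitl (tmap (@sym_eps T) idfun (sym_delta d z)) = z.
Proof.
apply: (sym_ext (f := @tunitl K _ \o (tmap (@sym_eps T) idfun \o
  @sym_delta _ _ _ _ d)) (g := idfun)) => X x /=.
have hc : compat (sval X) set0 I.
  apply/forallP => B; apply/implyP => BX.
  by rewrite (part_block_sub (svalP X) BX) orbT.
rewrite (sym_delta_gen _ _ hc) tmapE /= sym_eps_gen tunitlE scale1r.
apply: sgen_eq => [|B B1 B2] /=.
  apply/setP => B; rewrite inE; case: (boolP (B \in _)) => //= BX.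
  by rewrite (part_block_sub (svalP X) BX).
exact: (fam_irr x (B := B)).
Qed.

Lemma sym_delta_counitr (T : finType) (I : {set T}) (d : decomp I I set0)
    (z : sym_sp I) :
  tunitr (tmap idfun (@sym_eps T) (sym_delta d z)) = z.
Proof.
apply: (sym_ext (f := @tunitr K _ \o (tmap idfun (@sym_eps T) \o
  @sym_delta _ _ _ _ d)) (g := idfun)) => X x /=.
have hc : compat (sval X) I set0.
  apply/forallP => B; apply/implyP => BX.
  by rewrite (part_block_sub (svalP X) BX).
rewrite (sym_delta_gen _ _ hc) tmapE /= sym_eps_gen tunitrE scale1r.
apply: sgen_eq => [|B B1 B2] /=.
  apply/setP => B; rewrite inE; case: (boolP (B \in _)) => //= BX.
  by rewrite (part_block_sub (svalP X) BX).
exact: (fam_irr x (B := B)).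
Qed.

Definition sym_comonoid : comonoid K :=
  Comonoid (@ComonoidOn K sym_species
    (fun _ _ _ _ d => @sym_delta _ _ _ _ d) (fun T => @sym_eps T)
    sym_delta_nat sym_eps_nat sym_delta_coassoc
    sym_delta_counitl sym_delta_counitr).
End SymSpecies.

(* Main.v *)
Require Import Defs.
From mathcomp Require Import all_boot all_algebra.
From HB Require Import structures.
From mathcomp Require Import boolp.

Set Implicit Arguments.
Unset Strict Implicit.
Unset Printing Implicit Defensive.

Import GRing.Theory.
Local Open Scope ring_scope.

(* The comonoid morphism S(P(h)) -> h sends a tensor of primitive elements
   indexed by the blocks of X to the average, over the orderings of X, of their
   products.  Encoding the family as a primitive series a = (a_S), supported on
   the blocks, this is a^k / k! with k = #|X|, for the convolution powers of
   series; Delta (a^k) = sum_j 'C(k, j) a^j (x) a^(k - j) makes it a comonoid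
   morphism.

   Any comonoid morphism f : S(P(h)) -> h extending the inclusion of P(h) is
   invertible, by induction on I.  Fix a in I.  An element z of S(q)[I] is the
   sum over the sets S with a in S of pi1 of the S-factor of Delta_{S, I \ S} z,
   attached as a block to the other factor.  So if f z = 0, then
   Delta_{S, R} z = 0 for all proper decompositions, hence z is a single block,
   and z = 0.  For the surjectivity at y, apply this formula to the elements
   (f_S (x) f_R)^-1 (Delta_{S, R} y), for S <> I: the z obtained is such that
   y - f z is primitive, by coassociativity when a is in S and by cocommutativity
   when a is in R. *)

(** * Decompositions of a finite set into two subsets *)

Section Decompositions.
Variable T : finType.
Implicit Types U S R A B : {set T}.

Lemma decompP U S R :
  (forall x, (x \in U) = (x \in S) || (x \in R)) ->
  (forall x, x \in S -> x \notin R) -> decomp U S R.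
Proof.
move=> hU hd; apply/andP; split; first by apply/eqP/setP => x; rewrite inE hU.
by rewrite disjoint_subset; apply/subsetP => x /hd; rewrite inE.
Qed.

Lemma decompU U S R x : decomp U S R -> (x \in U) = (x \in S) || (x \in R).
Proof. by case/andP => /eqP <- _; rewrite inE. Qed.

Lemma decompF U S R x : decomp U S R -> x \in S -> x \in R = false.
Proof. by case/andP => _ /disjointFr h /h. Qed.

Lemma decompN U S R x : decomp U S R -> x \in S -> x \notin R.
Proof. by move=> d /(decompF d) ->. Qed.

Lemma decompD S U : S \subset U -> decomp U S (U :\: S).
Proof.
move=> /subsetP SU; apply: decompP => x; rewrite !inE; last by move=> ->.
by case: (boolP (x \in S)) => [/SU ->|].
Qed.

Lemma decomp_setD U S R : decomp U S R -> R = U :\: S.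
Proof.
move=> d; apply/setP => x; rewrite inE (decompU x d).
by case: (boolP (x \in S)) => [/(decompF d)|] //= ->.
Qed.
Lemma decomp_trace U S R A B : decomp U S R -> A \subset S -> B \subset R ->
  (A :|: B) :&: S = A.
Proof.
move=> d AS BR; apply/setP => x; rewrite !inE.
have/implyP := @decompN _ _ _ x d; have/implyP := subsetP AS x.
have/implyP := subsetP BR x.
by case: (x \in S); case: (x \in R); case: (x \in A); case: (x \in B).
Qed.
End Decompositions.

(** * Linearity and functoriality of the binary tensor product *)

Section TensorSums.
Variables (K : fieldType) (U V : lmodType K).

Lemma tpureDl (u u' : U) (v : V) : tpure (u + u') v = tpure u v + tpure u' v.
Proof. by rewrite -[u]scale1r tpurePl !scale1r. Qed.

Lemma tpureDr (u : U) (v v' : V) : tpure u (v + v') = tpure u v + tpure u v'.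
Proof. by rewrite -[v]scale1r tpurePr !scale1r. Qed.

Lemma tpureZl c (u : U) (v : V) : tpure (c *: u) v = c *: tpure u v.
Proof. by rewrite -[c *: u]addr0 tpurePl tpure0l addr0. Qed.

Lemma tpureZr c (u : U) (v : V) : tpure u (c *: v) = c *: tpure u v.
Proof. by rewrite -[c *: v]addr0 tpurePr tpure0r addr0. Qed.

Lemma tpure_linear (u : U) : linear (@tpure K U V u).
Proof. by move=> c v v'; apply: tpurePr. Qed.

HB.instance Definition _ (u : U) := GRing.isLinear.Build K V (tens U V) *:%R
  (@tpure K U V u) (tpure_linear u).

Lemma tpure_suml (I : Type) (r : seq I) (P : pred I) (F : I -> U) (v : V) :
  tpure (\sum_(i <- r | P i) F i) v = \sum_(i <- r | P i) tpure (F i) v.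
Proof.
apply: (big_morph (fun u => tpure u v)); last exact: tpure0l.
by move=> x y; apply: tpureDl.
Qed.

Lemma tpure_sumr (I : Type) (r : seq I) (P : pred I) (u : U) (F : I -> V) :
  tpure u (\sum_(i <- r | P i) F i) = \sum_(i <- r | P i) tpure u (F i).
Proof.
apply: (big_morph (tpure u)); last exact: tpure0r.
by move=> x y; apply: tpureDr.
Qed.
End TensorSums.

Section TensorMaps.
Variable K : fieldType.

(** Functoriality of the tensor product, stated for commuting squares: one rewriting replaces a
    composite in each factor, without forming the composite linear maps. *)
Lemma tmap_square (U V U1 V1 U2 V2 U3 V3 : lmodType K)
    (f1 : {linear U1 -> U3}) (g1 : {linear V1 -> V3})
    (f1' : {linear U -> U1}) (g1' : {linear V -> V1})
    (f2 : {linear U2 -> U3}) (g2 : {linear V2 -> V3})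
    (f2' : {linear U -> U2}) (g2' : {linear V -> V2}) :
  (forall u, f1 (f1' u) = f2 (f2' u)) -> (forall v, g1 (g1' v) = g2 (g2' v)) ->
  forall w, tmap f1 g1 (tmap f1' g1' w) = tmap f2 g2 (tmap f2' g2' w).
Proof.
move=> hf hg.
apply: (@tens_ext K U V _ (tmap f1 g1 \o tmap f1' g1') (tmap f2 g2 \o tmap f2' g2')).
by move=> u v /=; rewrite !tmapE hf hg.
Qed.

Lemma tmap_id (U V : lmodType K) (f : {linear U -> U}) (g : {linear V -> V}) :
  f =1 id -> g =1 id -> tmap f g =1 id.
Proof.
move=> hf hg; apply: (@tens_ext K U V _ (tmap f g) idfun) => u v /=.
by rewrite tmapE hf hg.
Qed.

Lemma tmap_can (U V U' V' : lmodType K)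
    (f : {linear U -> U'}) (g : {linear V -> V'})
    (f' : {linear U' -> U}) (g' : {linear V' -> V}) :
  cancel f f' -> cancel g g' -> cancel (tmap f g) (tmap f' g').
Proof.
move=> hf hg w.
have := @tmap_square _ _ _ _ _ _ _ _ f' g' f g idfun idfun idfun idfun hf hg w.
by rewrite !tmap_id.
Qed.

(** Surjectivity gives a section by choice; injectivity makes it a two-sided inverse and forces it
    to be linear. *)
Lemma bijective_linear (U V : lmodType K) (f : {linear U -> V}) :
  injective f -> (forall y, exists x, f x = y) ->
  exists g : {linear V -> U}, cancel f g /\ cancel g f.
Proof.
move=> fI /choice[g gK].
have fK : cancel f g by move=> x; apply: fI; rewrite gK.
have gL : linear g by move=> c x y; apply: fI; rewrite linearP !gK.
by exists (HB.pack_for {linear V -> U} g (GRing.isLinear.Build K V U *:%R g gL)).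
Qed.
End TensorMaps.

(** * Connected bimonoids: the empty set and the coproducts with an empty part *)

Section Connected.
Variables (K : fieldType) (h : bimonoid K) (h_conn : connected h) (T : finType).

Definition one0 : sp h (set0 : {set T}) := Defs.iota h T (1 : K^o).

Lemma eps_one0 : eps h T one0 = 1.
Proof. exact: bi_eps_iota. Qed.

(** Both [x] and [one0] are multiples of the basis vector [e]. The multiple [c1] giving [one0] is
    nonzero because the counit of [one0] is 1, so [one0] is a basis too, and the counit reads off
    the coordinate. *)
Lemma connectedE (x : sp h (set0 : {set T})) : x = (eps h T x : K) *: one0.
Proof.
have [e he] := h_conn T; have [c [xE _]] := he x.
have [c1 [oE _]] := he one0; have eo := eps_one0.
rewrite {1}oE linearZ /= in eo; have c1ne : c1 != 0.
  by apply: contra_eq_neq eo => ->; rewrite scale0r eq_sym (oner_eq0 K).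
have ee : (eps h T e : K) = c1^-1.
  by apply: (mulfI c1ne); rewrite mulfV.
have xc : (eps h T x : K) = c * c1^-1 by rewrite -ee {1}xE linearZ.
by rewrite xc oE scalerA mulfVK.
Qed.

(** The left factor of the coproduct lies on the line spanned by [one0], where the counit loses no
    information; the counit axiom therefore determines this coproduct. *)
Lemma delta_set0l (I : {set T}) (d : decomp I set0 I) (x : sp h I) :
  delta h d x = tpure one0 x.
Proof.
rewrite -[in RHS](delta_counitl h d x).
elim/(@tens_ind K): (delta h d x) => [|c a b IHa IHb|u v].
- by rewrite !linear0.
- by rewrite !linearP /= -IHa -IHb.
by rewrite tmapE tunitlE tpureZr -tpureZl -connectedE.
Qed.

Lemma delta_set0r (I : {set T}) (d : decomp I I set0) (x : sp h I) :
  delta h d x = tpure x one0.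
Proof.
rewrite -[in RHS](delta_counitr h d x).
elim/(@tens_ind K): (delta h d x) => [|c a b IHa IHb|u v].
- by rewrite !linear0 tpure0l.
- by rewrite !linearP tpurePl -IHa -IHb.
by rewrite tmapE tunitrE tpureZl -tpureZr -connectedE.
Qed.
End Connected.

(** * Series of elements of a bimonoid *)

Section Series.
Variables (K : fieldType) (h : bimonoid K) (T : finType).
Implicit Types U S R A B : {set T}.

Definition ser := forall U : {set T}, sp h U.
Implicit Types a b : ser.

(** The summand at [S] of the convolution product. As [mu] needs a proof that [S] and its complement
    decompose [U], the inclusion is tested inside the term, with default value 0; the sum can then
    range over all subsets of [T]. *)
Definition smul_term a b U S : sp h U :=
  if @idP (S \subset U) is ReflectT SU
  then mu h (decompD SU) (tpure (a S) (b (U :\: S))) else 0.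

Definition smul a b : ser := fun U => \sum_(S : {set T}) smul_term a b U S.

Definition sone : ser := fun U =>
  if U =P set0 is ReflectT e then ecast V (sp h V) (esym e) (one0 h T) else 0.

Fixpoint spow a k : ser := if k is k'.+1 then smul a (spow a k') else sone.

Lemma smul_termE a b U S R (d : decomp U S R) :
  smul_term a b U S = mu h d (tpure (a S) (b R)).
Proof.
have E := decomp_setD d; subst R; rewrite /smul_term.
case: {-}_ / idP => [SU|/negP]; last by rewrite (decomp_subl d).
by rewrite (bool_irrelevance (decompD SU) d).
Qed.

Lemma smul_term0 a b U S : ~~ (S \subset U) -> smul_term a b U S = 0.
Proof. by rewrite /smul_term; case: {-}_ / idP => // SU; rewrite SU. Qed.

Lemma sone_set0 : sone set0 = one0 h T.
Proof.
by rewrite /sone; case: {-}_ / eqP => [e|//]; rewrite (eq_irrelevance (esym e) erefl).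
Qed.

Lemma sone_neq0 U : U != set0 -> sone U = 0.
Proof. by rewrite /sone => /eqP U0; case: {-}_ / eqP. Qed.

Lemma mu_one0l U R (d : decomp U set0 R) b : mu h d (tpure (one0 h T) (b R)) = b U.
Proof.
have E : R = U by rewrite (decomp_setD d) setD0.
subst R; have := mu_unitl h d (tpure (1 : K^o) (b U)).
by rewrite tmapE tunitlE scale1r.
Qed.

Lemma mu_one0r U R (d : decomp U U R) (u : sp h U) : mu h d (tpure u (sone R)) = u.
Proof.
have E : R = set0 by rewrite (decomp_setD d) setDv.
subst R; rewrite sone_set0; have := mu_unitr h d (tpure u (1 : K^o)).
by rewrite tmapE tunitrE scale1r.
Qed.

Lemma mul_sone a U : smul a sone U = a U.
Proof.
rewrite /smul (bigD1 U) //= big1 ?addr0 => [|S SU].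
  by rewrite (smul_termE _ _ (decompD (subxx U))) mu_one0r.
rewrite /smul_term; case: {-}_ / idP => // h'; rewrite sone_neq0 ?tpure0r ?linear0 //.
by apply: contraNneq SU => /eqP; rewrite setD_eq0 eqEsubset h'.
Qed.

Lemma sone_mul b U : smul sone b U = b U.
Proof.
rewrite /smul (bigD1 set0) //= big1 ?addr0 => [|S S0].
  by rewrite (smul_termE _ _ (decompD (sub0set U))) sone_set0 mu_one0l.
rewrite /smul_term; case: {-}_ / idP => // SU.
by rewrite sone_neq0 // tpure0l linear0.
Qed.

Lemma delta_sone U S R (d : decomp U S R) :
  delta h d (sone U) = tpure (sone S) (sone R).
Proof.
have [U0|U0] := eqVneq U set0.
  subst U; have S0 : S = set0 by apply/eqP; rewrite -subset0 (decomp_subl d).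
  have R0 : R = set0 by apply/eqP; rewrite -subset0 (decomp_subr d).
  by subst S R; rewrite sone_set0 /one0 bi_delta_iota tmapE.
rewrite (sone_neq0 U0) linear0; have [S0|S0] := eqVneq S set0.
  have R0 : R != set0.
    by apply: contra_neq U0 => R0; case/andP: d => /eqP <- _; rewrite S0 R0 setU0.
  by rewrite (sone_neq0 R0) tpure0r.
by rewrite (sone_neq0 S0) tpure0l.
Qed.

Definition primitive_ser a : Prop :=
  a set0 = 0 /\ forall U S R (d : decomp U S R),
    S != set0 -> R != set0 -> delta h d (a U) = 0.

Hypothesis h_conn : connected h.

(** As [sone] vanishes on nonempty sets, this formula covers at once the primitivity condition and
    the two degenerate coproducts, which are given by connectedness. When [S] and [R] are both
    empty, everything is 0 since [a set0 = 0]. *)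
Lemma delta_prim a U S R (d : decomp U S R) : primitive_ser a ->
  delta h d (a U) = tpure (a S) (sone R) + tpure (sone S) (a R).
Proof.
case=> a0 ha; have [S0|S0] := eqVneq S set0.
  subst S; have E : R = U by rewrite (decomp_setD d) setD0.
  by subst R; rewrite delta_set0l // a0 tpure0l add0r sone_set0.
rewrite (sone_neq0 S0) tpure0l addr0; have [R0|R0] := eqVneq R set0.
  subst R; have E : S = U.
    by case/andP: d => /eqP <- _; rewrite setU0.
  by subst S; rewrite delta_set0r // sone_set0.
by rewrite (ha _ _ _ d) // sone_neq0 // tpure0r.
Qed.

(* [Delta] is multiplicative for the convolution product of series: a subset of
   [S :|: R] is the union of its traces on [S] and [R]. *)
Lemma delta_smul_prim a b n (c : nat -> K) (b1 b2 : nat -> ser) :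
  primitive_ser a ->
  (forall U S R (d : decomp U S R), delta h d (b U) =
     \sum_(0 <= j < n) c j *: tpure (b1 j S) (b2 j R)) ->
  forall U S R (d : decomp U S R), delta h d (smul a b U) =
    \sum_(0 <= j < n) c j *: (tpure (smul a (b1 j) S) (b2 j R) +
                              tpure (b1 j S) (smul a (b2 j) R)).
Proof.
move=> ha hb U S R d.
(* The contribution of the subset [A :|: B]. The unit series comes from [delta_prim]; summing its
   terms over all [B] (resp. [A]) gives back [b2 j] (resp. [b1 j]), by [sone_mul]. *)
pose G A B : tens (sp h S) (sp h R) := \sum_(0 <= j < n) c j *:
  (tpure (smul_term a (b1 j) S A) (smul_term sone (b2 j) R B) +
   tpure (smul_term sone (b1 j) S A) (smul_term a (b2 j) R B)).
have hG A B : A \subset S -> B \subset R ->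
    delta h d (smul_term a b U (A :|: B)) = G A B.
  move=> AS BR; have AS' := subsetP AS; have BR' := subsetP BR.
  have dU : decomp U (A :|: B) (U :\: (A :|: B)).
    by apply: decompD; case/andP: d => /eqP <- _; rewrite setUSS.
  have dAB : decomp (A :|: B) A B.
    apply: decompP => x; rewrite ?inE // => /AS' xS.
    by apply/negP => /BR'; rewrite (decompF d xS).
  have dR : decomp (U :\: (A :|: B)) (S :\: A) (R :\: B).
    apply: decompP => x; rewrite !inE; last first.
      by case/andP => _ /(decompF d) ->; rewrite andbF.
    rewrite (decompU x d).
    have/implyP := AS' x; have/implyP := BR' x; have/implyP := @decompN _ _ _ _ x d.
    by case: (x \in S); case: (x \in R); case: (x \in A); case: (x \in B).
  rewrite (smul_termE _ _ dU) (bi_delta_mu dU d dAB dR (decompD AS) (decompD BR)).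
  rewrite tmapE (delta_prim dAB ha) (hb _ _ _ dR) tpure_sumr.
  rewrite [tinter _]linear_sum [tmap _ _ _]linear_sum /=.
  apply: eq_bigr => j _; rewrite tpureZr !linearZ /= tpureDl !linearD /=.
  rewrite !tinterE !tmapE.
  by rewrite !(smul_termE _ _ (decompD AS)) !(smul_termE _ _ (decompD BR)).
have -> : delta h d (smul a b U) =
    \sum_(A : {set T} | A \subset S) \sum_(B : {set T} | B \subset R) G A B.
  rewrite /smul (bigID (fun Q : {set T} => Q \subset U)) /= [X in _ + X]big1 ?addr0;
    last by move=> Q; apply: smul_term0.
  rewrite linear_sum /= pair_big /=.
  rewrite (reindex_onto (fun p : {set T} * {set T} => p.1 :|: p.2)
    (fun Q => (Q :&: S, Q :&: R))) /=; last first.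
    move=> Q QU; rewrite -setIUr; have /andP[/eqP -> _] := d; exact/setIidPl.
  apply: eq_big => [[A B]|[A B]] /=; first last.
    by case/andP => _ /eqP[<- <-]; rewrite hG ?subsetIr.
  apply/andP/andP => -[].
    by move=> _ /eqP[<- <-]; rewrite !subsetIr.
  move=> AS BR; split; first by have /andP[/eqP <- _] := d; rewrite setUSS.
  apply/eqP; congr pair; first exact: decomp_trace d AS BR.
  by rewrite setUC (@decomp_trace _ U R S) // decompC.
rewrite /G; under eq_bigr => A _ do rewrite exchange_big /=.
rewrite exchange_big /=; apply: eq_bigr => j _.
have smulE x y V : smul x y V = \sum_(A : {set T} | A \subset V) smul_term x y V A.
  rewrite /smul (bigID (fun Q : {set T} => Q \subset V)) /= [X in _ + X]big1 ?addr0 //.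
  by move=> Q; apply: smul_term0.
rewrite -(sone_mul (b2 j) R) -(sone_mul (b1 j) S) !smulE.
rewrite !tpure_suml -big_split /= scaler_sumr; apply: eq_bigr => A _.
rewrite !tpure_sumr -big_split /= scaler_sumr; apply: eq_bigr => B _ //.
Qed.

(** The binomial theorem, by induction on [k]: the new factor [a] goes either to the left or to the
    right, and Pascal's rule collects the two sums. *)
Lemma delta_spow a k : primitive_ser a -> forall U S R (d : decomp U S R),
  delta h d (spow a k U) =
  \sum_(0 <= j < k.+1) 'C(k, j)%:R *: tpure (spow a j S) (spow a (k - j) R).
Proof.
move=> ha; elim: k => [|k IH] U S R d.
  by rewrite big_nat1 /= scale1r delta_sone.
rewrite /= (@delta_smul_prim a _ k.+1 (fun j => 'C(k, j)%:R) (fun j => spow a j)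
  (fun j => spow a (k - j)) ha IH) /=.
under eq_bigr => j _ do rewrite scalerDr.
rewrite big_split /= [RHS]big_nat_recl //=.
under [in RHS]eq_bigr => j _ do rewrite binS natrD scalerDl subSS.
rewrite big_split /= addrC [RHS]addrA; congr (_ + _).
rewrite [X in _ = _ + X]big_nat_recr //= (@bin_small k k.+1) // mulr0n scale0r addr0.
rewrite big_nat_recl //= subn0 !bin0; congr (_ + _).
(* The bound [j < k] has to be at hand: subtraction being truncated, [k - j] is a successor only in
   that range. *)
rewrite [LHS]big_seq_cond [RHS]big_seq_cond.
apply: eq_bigr => j; rewrite mem_index_iota andbT => /= jk.
by rewrite (_ : k - j = (k - j.+1).+1)%N // subnSK.
Qed.
End Series.

(** * Subpartitions, and the support of powers of a series *)

Lemma partition_part_in (T : finType) (X Y : {set {set T}}) (I U : {set T}) :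
  partition X I -> Y \subset X -> partition Y U -> Y = part_in X U.
Proof.
move=> PX YX PY; apply/eqP; rewrite eqEsubset; apply/andP; split.
  apply/subsetP => B BY; rewrite inE (subsetP YX) //=.
  exact: (part_block_sub PY).
apply/subsetP => B; rewrite inE => /andP[BX BU].
(* The block of [Y] through a point [x] of [B] is a block of [X] that meets [B], hence is [B]. *)
have /set0Pn[x xB] := part_block_neq0 PX BX.
have : x \in cover Y by rewrite (cover_partition PY) (subsetP BU).
case/bigcupP => C CY xC; suff -> : B = C by [].
apply/eqP; apply: contraT => BC; have /and3P[_ /trivIsetP tX _] := PX.
by rewrite (disjointFr (tX _ _ BX (subsetP YX _ CY) BC) xB) in xC.
Qed.

Lemma partition_notin (T : finType) (Y : {set {set T}}) (I S R : {set T}) :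
  decomp I S R -> partition Y R -> S != set0 -> S \notin Y.
Proof.
move=> d PY; apply: contraNN => SY.
by rewrite (decomp_sub2 d (subxx S) (part_block_sub PY SY)).
Qed.

Lemma partition_setU1 (T : finType) (Y : {set {set T}}) (I S R : {set T}) :
  decomp I S R -> partition Y R -> S != set0 -> partition (S |: Y) I.
Proof.
move=> d PY S0; have /and3P[/eqP cY /trivIsetP tY Y0] := PY.
apply/and3P; split; last by rewrite !inE negb_or Y0 andbT eq_sym.
  by rewrite /cover bigcup_setU big_set1 -/(cover Y) cY; case/andP: d.
have dS B : B \in Y -> [disjoint S & B].
  move/(part_block_sub PY) => BR; have /andP[_ SR] := d.
  by rewrite disjoint_sym (disjointWl BR) // disjoint_sym.
apply/trivIsetP => B C; rewrite !inE => /orP[/eqP->|BY] /orP[/eqP->|CY].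
- by rewrite eqxx.
- by move=> _; apply: dS.
- by move=> _; rewrite disjoint_sym; apply: dS.
- exact: tY.
Qed.

(** A converse to [part_in_partition]. A block has a point in [S] or in [R], say in [S]; that point
    is covered by a block contained in [S], which must be the given one. *)
Lemma partition_compat (T : finType) (X : {set {set T}}) (I S R : {set T}) :
  partition X I -> decomp I S R ->
  partition (part_in X S) S -> partition (part_in X R) R -> compat X S R.
Proof.
move=> PX d PS PR; apply/forallP => B; apply/implyP => BX.
have /set0Pn[u uB] := part_block_neq0 PX BX.
have uI := subsetP (part_block_sub PX BX) u uB.
have H (V : {set T}) : u \in V -> partition (part_in X V) V -> B \subset V.
  move=> uV /cover_partition cV.
  have : u \in cover (part_in X V) by rewrite cV.
  case/bigcupP => C; rewrite inE => /andP[CX CV] uC; suff -> : B = C by [].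
  apply/eqP; apply: contraT => BC; have /and3P[_ /trivIsetP tX _] := PX.
  by rewrite (disjointFr (tX _ _ BX CX BC) uB) in uC.
by move: uI; rewrite (decompU u d) => /orP[/H->|/H->]; rewrite ?orbT.
Qed.

Section Support.
Variables (K : fieldType) (h : bimonoid K) (T : finType).
Implicit Types (U S R A B : {set T}) (a b : ser h T).

Lemma spow_local a b k U :
  (forall S, S \subset U -> a S = b S) -> spow a k U = spow b k U.
Proof.
elim: k U => //= k IH U hab; apply: eq_bigr => S _; rewrite /smul_term.
case: {-}_ / idP => // SU; rewrite hab // IH // => R RU; apply: hab.
exact: subset_trans RU (subsetDl _ _).
Qed.

(** At [U], the power is a sum of products over the decompositions of [U] into [k] successive sets;
    a nonzero product uses only members of [X], which are nonempty and disjoint. When [X] is itself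
    a partition, this pins down the exponent: it is the number of blocks inside [U]. *)
Lemma spow_support (X : {set {set T}}) a k U :
  set0 \notin X -> (forall S, S \notin X -> a S = 0) -> spow a k U <> 0 ->
  exists Y : {set {set T}}, [/\ Y \subset X, partition Y U & #|Y| = k].
Proof.
move=> X0 aX; elim: k U => [|k IH] U /= hU.
  have [E|/(sone_neq0 h)//] := eqVneq U set0; exists set0.
  by rewrite sub0set E partition_set0 cards0.
have [S hS] : exists S, smul_term a (spow a k) U S <> 0.
  apply: contrapT => hS; apply: hU; rewrite /smul big1 // => S _.
  by apply: contrapT => h'; apply: hS; exists S.
move: hS; rewrite /smul_term; case: {-}_ / idP => // SU hS.
have SX : S \in X.
  by apply: contra_notT hS => /aX ->; rewrite tpure0l linear0.
have [Y [YX PY cY]] : exists Y : {set {set T}},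
    [/\ Y \subset X, partition Y (U :\: S) & #|Y| = k].
  by apply: IH => h0; apply: hS; rewrite h0 tpure0r linear0.
have dS := decompD SU; have S0 : S != set0 by apply: contraNneq X0 => <-.
exists (S |: Y); split; last by rewrite cardsU1 (partition_notin dS) ?cY.
  by rewrite subUset sub1set SX.
exact: partition_setU1 dS PY S0.
Qed.

(** The parameter [z] only affects the value at [B], and each nonzero product has exactly one factor
    at [B]: the set [U] contains [B], and the other sets that meet [B] carry 0. In the induction,
    the first set [S] is [B], or is disjoint from [B], or contributes 0. *)
Lemma spow_linear (V : lmodType K) (a : V -> ser h T) B k :
  B != set0 -> (forall z S, S != B -> a z S = a 0 S) ->
  linear (fun z => a z B) ->
  (forall S, S != B -> ~~ [disjoint S & B] -> a 0 S = 0) ->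
  forall U, B \subset U -> linear (fun z => spow (a z) k U).
Proof.
move=> B0 aB aL aD; elim: k => [|k IH] U BU c x y /=.
  rewrite sone_neq0 ?scaler0 ?addr0 //.
  by apply: contraNneq B0 => U0; rewrite -subset0 -U0.
rewrite /smul scaler_sumr -big_split /=; apply: eq_bigr => S _.
rewrite /smul_term; case: {-}_ / idP => [SU|]; last by rewrite scaler0 addr0.
have [SB|SB] := eqVneq S B.
  (* No subset of [U :\: B] is the nonempty set [B], so the remaining factors do not depend on
     [z]. *)
  subst S; rewrite aL; have E z : spow (a z) k (U :\: B) = spow (a 0) k (U :\: B).
    apply: spow_local => R; rewrite subsetD => /andP[_ RB]; apply: aB.
    apply: contraNneq B0 => E; move: RB; rewrite E -setI_eq0 setIid; exact.
  by rewrite (E x) (E y) E tpurePl linearP.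
rewrite !(aB _ S SB); have [SBd|SBd] := boolP [disjoint S & B].
  have BUS : B \subset U :\: S by rewrite subsetD BU disjoint_sym.
  by rewrite (IH _ BUS) tpurePr linearP.
by rewrite aD // !tpure0l !linear0 ?scaler0 addr0.
Qed.
End Support.

(** * Naturality of the powers of a series *)

Lemma one0_nat (K : fieldType) (h : bimonoid K) (T T' : finType)
    (s : fbij (set0 : {set T}) (set0 : {set T'})) :
  sp_map h s (one0 h T) = one0 h T'.
Proof. exact: iota_nat. Qed.

Lemma fb_im_im (T T' : finType) (A : {set T}) (B : {set T'}) (s : fbij A B)
    (C : {set T'}) : C \subset B -> fb_im s (fb_im (fb_sym s) C) = C.
Proof. by move=> CB; have := fb_imK (fb_sym s) CB; case: s. Qed.

Lemma fb_eq0 (T T' : finType) (A : {set T}) (B : {set T'}) (s : fbij A B) :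
  (A == set0) = (B == set0).
Proof. by rewrite -(fb_im_full s) fb_im_eq0. Qed.

Lemma fb_restr_trans (T T' : finType) (A S C : {set T}) (A' S' C' : {set T'})
    (s : fbij A A') (t : fbij S S') (u : fbij C C') :
  C \subset S -> fb_restr s t -> fb_restr t u -> fb_restr s u.
Proof.
by move=> CS st tu x xC xA; rewrite (tu x xC (subsetP CS x xC)); apply: st.
Qed.

(** Taking images under [s] matches the subsets of [A] with those of [B], hence the terms of the two
    products. The hypothesis bears on all restrictions of [s], so that it passes to [A :\: S] in the
    induction. *)
Lemma spow_nat (K : fieldType) (h : bimonoid K) (T T' : finType)
    (a : ser h T) (b : ser h T') k :
  forall (A : {set T}) (B : {set T'}) (s : fbij A B),
  (forall S S' (t : fbij S S'), S \subset A -> fb_restr s t ->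
     b S' = sp_map h t (a S)) ->
  sp_map h s (spow a k A) = spow b k B.
Proof.
elim: k => [|k IH] A B s hab /=.
  have [A0|A0] := eqVneq A set0.
    have B0 : B = set0 by apply/eqP; rewrite -(fb_eq0 s) A0.
    by subst A B; rewrite !sone_set0 one0_nat.
  by rewrite !sone_neq0 -?(fb_eq0 s) // linear0.
rewrite /smul (bigID (fun S : {set T} => S \subset A)) /= [X in _ + X]big1 ?addr0;
  last by move=> S; apply: smul_term0.
rewrite [RHS](bigID (fun S : {set T'} => S \subset B)) /= [X in _ = _ + X]big1 ?addr0;
  last by move=> S; apply: smul_term0.
rewrite linear_sum /=.
rewrite [RHS](reindex_onto (fb_im s) (fb_im (fb_sym s))) /=; last first.
  by move=> S SB; apply: fb_im_im.
apply: eq_big => [S|S SA].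
  rewrite fb_im_sub /=; apply/idP/eqP => [SA|<-]; [exact: fb_imK|exact: fb_im_sub].
rewrite (smul_termE _ _ (decompD SA)).
have dB := fb_im_decomp s (decompD SA).
rewrite (smul_termE _ _ dB).
rewrite (mu_nat h _ dB (fb_res_restr s SA) (fb_res_restr s (subsetDl A S))).
rewrite tmapE (hab _ _ (fb_res s SA)) //; last exact: fb_res_restr.
rewrite (IH _ _ (fb_res s (subsetDl A S))) // => C C' t CA tt.
apply: hab; first exact: subset_trans CA (subsetDl _ _).
apply: (fb_restr_trans CA _ tt); exact: fb_res_restr.
Qed.

(** * The morphism from S(P(h)) to h *)

Section TotalFamilies.
Variables (K : fieldType) (q : species K) (T : finType) (X : {set {set T}}).

(** Extension by zero to all subsets: families over different partitions then have the same type,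
    and a family of primitive elements becomes a series. *)
Definition tot (x : fam q X) : forall B : {set T}, sp q B := fun B =>
  if @idP (B \in X) is ReflectT BX then x (exist _ B BX) else 0.

Lemma tot_in (x : fam q X) B (BX : B \in X) : tot x B = x (exist _ B BX).
Proof.
by rewrite /tot; case: {-}_ / idP => // h; rewrite (bool_irrelevance h BX).
Qed.

Lemma tot_out (x : fam q X) B : B \notin X -> tot x B = 0.
Proof. by move=> BX; rewrite /tot; case: {-}_ / idP => // h; rewrite h in BX. Qed.

Lemma tot_dfwith (x : fam q X) (B : {B | B \in X}) (z : sp q (sval B)) :
  tot (dfwith x z) = dfwith (tot x) z.
Proof.
apply: functional_extensionality_dep => C; have [<-|BC] := eqVneq (sval B) C.
  rewrite dfwith_in; case: B z => B BX z.
  by rewrite (tot_in _ BX) dfwith_in.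
rewrite dfwith_out //; have [CX|CX] := boolP (C \in X); last by rewrite !tot_out.
by rewrite !(tot_in _ CX) dfwith_out.
Qed.

End TotalFamilies.

Section Exponential.
Variables (K : fieldType) (h : bimonoid K).

Section Space.
Variables (T : finType).
Implicit Types (I S R : {set T}).

Definition block_ser (X : {set {set T}}) (x : fam (primitive h) X) : ser h T :=
  fun S => pval (tot x S : prim h S).

Lemma primitive_block_ser (X : {set {set T}}) (x : fam (primitive h) X) :
  primitive_ser (block_ser x).
Proof.
split=> [|U S R d S0 R0]; rewrite /block_ser.
  by have := pvalP (tot x set0 : prim h _); rewrite /is_primitive eqxx => /eqP.
have := pvalP (tot x U : prim h _); rewrite /is_primitive ifN.
  by move/asboolP/(_ _ _ d S0 R0).
by apply: contraNneq S0 => U0; rewrite -subset0 -U0 (decomp_subl d).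
Qed.

Definition exp_fam I (X : parts I) (x : fam (primitive h) (sval X)) : sp h I :=
  (#|sval X|`!%:R)^-1 *: spow (block_ser x) #|sval X| I.

Lemma exp_fam_multilin I (X : parts I) : multilin (@exp_fam I X).
Proof.
move=> v B c x y; rewrite /exp_fam !scalerA mulrC -scalerA -scalerDr.
congr (_ *: _); pose a z := block_ser (dfwith v (i := B) z).
have aE z S : a z S = pval (dfwith (tot v) z S : prim h S).
  by rewrite /a /block_ser tot_dfwith.
apply: (@spow_linear K h T _ a (sval B)).
- exact: (part_block_neq0 (svalP X) (svalP B)).
- by move=> z S SB; rewrite !aE !dfwith_out // eq_sym.
- by move=> k u w; rewrite !aE !dfwith_in.
- move=> S SB SBd; rewrite aE dfwith_out 1?eq_sym // tot_out //.
  apply: contraNN SBd => SX; have /and3P[_ /trivIsetP tX _] := svalP X.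
  exact: (tX _ _ SX (svalP B) SB).
- exact: (part_block_sub (svalP X) (svalP B)).
Qed.

Definition exp_map I (z : sym_sp (primitive h) I) : sp h I :=
  \sum_(X : parts I) mlift (@exp_fam_multilin I X) (z X).

Lemma exp_map_linear I : linear (@exp_map I).
Proof.
move=> c x y; rewrite /exp_map scaler_sumr -big_split /=; apply: eq_bigr => X _.
exact: (linearP (mlift (@exp_fam_multilin I X))).
Qed.

HB.instance Definition _ I := GRing.isLinear.Build K (sym_sp (primitive h) I)
  (sp h I) *:%R (@exp_map I) (@exp_map_linear I).

Lemma exp_map_gen I (X : parts I) (x : fam (primitive h) (sval X)) :
  exp_map (sgen x) = exp_fam x.
Proof.
rewrite /exp_map (bigD1 X) //= big1 ?addr0 => [|Y YX].
  by rewrite /sgen dinj_in mliftE.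
by rewrite /sgen dinj_out ?linear0 // eq_sym.
Qed.
End Space.

(** A bijection preserves the number of blocks, hence both the exponent and the factorial; the rest
    is naturality of powers. *)
Lemma exp_map_nat (T T' : finType) (A : {set T}) (B : {set T'}) (s : fbij A B) z :
  exp_map (sym_map s z) = sp_map h s (exp_map z).
Proof.
apply: (sym_ext (f := @exp_map _ B \o @sym_map _ _ _ _ _ _ s)
                (g := sp_map h s \o @exp_map _ A)) => X x /=.
have [Y [y [EY hy]]] := sym_map_push s x; rewrite (sym_map_gen EY hy).
rewrite !exp_map_gen /exp_fam linearZ /=.
have -> : #|sval Y| = #|sval X|.
  rewrite EY card_in_imset // => C D CX DX E.
  rewrite -(fb_imK s (part_block_sub (svalP X) CX)) E.
  by rewrite fb_imK // (part_block_sub (svalP X) DX).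
congr (_ *: _); apply/esym/spow_nat => S S' t SA st.
have ES : S' = fb_im s S by rewrite -(fb_im_full t) (fb_im_restr SA st).
rewrite /block_ser; have [SX|SX] := boolP (S \in sval X).
  have SY : S' \in sval Y by rewrite EY ES imset_f.
  by rewrite (tot_in _ SX) (tot_in _ SY) (hy (exist _ S SX) (exist _ S' SY) t).
rewrite !tot_out ?linear0 // EY ES; apply: contraNN SX => /imsetP[C CX E].
rewrite -(fb_imK s SA) E fb_imK //; exact: (part_block_sub (svalP X)).
Qed.

Hypotheses (charK0 : [pchar K] =i pred0) (h_conn : connected h).

(** In the binomial expansion of the coproduct of the [k]-th power, a term survives only if [X] is
    compatible with the decomposition and its exponent [j] is the number [p] of blocks inside [S].
    Its coefficient is right because [k! = 'C(k, p) * p! * (k - p)!], where characteristic 0 makes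
    all these integers invertible. *)
Lemma exp_map_delta (T : finType) (I S R : {set T}) (d : decomp I S R) z :
  delta h d (exp_map z) = tmap (@exp_map T S) (@exp_map T R) (sym_delta d z).
Proof.
apply: (sym_ext (f := delta h d \o @exp_map T I)
  (g := tmap (@exp_map T S) (@exp_map T R) \o @sym_delta _ _ _ _ _ _ d)) => X x /=.
have X0 : set0 \notin sval X by have /and3P[] := svalP X.
rewrite exp_map_gen /exp_fam linearZ /= delta_spow //; last exact: primitive_block_ser.
have supp k U : spow (block_ser x) k U <> 0 ->
    partition (part_in (sval X) U) U /\ #|part_in (sval X) U| = k.
  case/(spow_support X0) => [Q QX|Y [YX PY <-]].
    by rewrite /block_ser tot_out.
  by rewrite -(partition_part_in (svalP X) YX PY).
have [hc|nc] := boolP (compat (sval X) S R); last first.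
  (* A nonzero summand would make the blocks inside [S] cover [S] and those inside [R] cover [R],
     against the incompatibility of [X]. *)
  rewrite sym_delta_gen0 // linear0 big1 ?scaler0 // => j _.
  apply: contrapT => hj; case/negP: nc.
  have [S0|/supp[PS _]] := pselect (spow (block_ser x) j S = 0).
    by case: hj; rewrite S0 tpure0l scaler0.
  have [R0|/supp[PR _]] := pselect (spow (block_ser x) (#|sval X| - j) R = 0).
    by case: hj; rewrite R0 tpure0r scaler0.
  exact: partition_compat (svalP X) d PS PR.
rewrite (sym_delta_gen _ _ hc) tmapE /= !exp_map_gen /exp_fam /=.
have cX : (#|part_in (sval X) S| + #|part_in (sval X) R| = #|sval X|)%N.
  rewrite -cardsUI (_ : _ :&: _ = set0) ?cards0 ?addn0.
    congr #|pred_of_set _|; apply/setP => B; rewrite !inE -andb_orr.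
    case: (boolP (B \in _)) => //= BX.
    by move/forallP/(_ B): hc; rewrite BX.
  apply/setP => B; rewrite !inE; apply/negP => /andP[/andP[BX BS] /andP[_ BR]].
  by move: X0; rewrite -(decomp_sub2 d BS BR) BX.
(* Powers at [V] only see subsets of [V], where the family and its restriction to the blocks inside
   [V] define the same series. *)
have loc (V : {set T}) k :
    spow (block_ser (fam_res (part_in_sub (sval X) V) x)) k V = spow (block_ser x) k V.
  apply: spow_local => Q QU; rewrite /block_ser.
  have [QX|QX] := boolP (Q \in sval X); last by rewrite !tot_out // inE negb_and QX.
  have QV : Q \in part_in (sval X) V by rewrite inE QX.
  by rewrite (tot_in _ QX) (tot_in _ QV) /fam_res; congr pval;
    exact: (fam_irr x (B := Q)).
rewrite !loc //; set p := #|part_in (sval X) S| in cX *.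
rewrite (bigD1_seq p) /= ?iota_uniq ?mem_index_iota ?ltnS -?cX ?leq_addr //; last first.
  by rewrite andbT mem_iota.
rewrite big1_seq ?addr0 => [|j /andP[jp _]]; last first.
  have [->|/supp[_ E]] := pselect (spow (block_ser x) j S = 0).
    by rewrite tpure0l scaler0.
  by rewrite -E eqxx in jp.
rewrite addKn tpureZl tpureZr !scalerA; congr (_ *: _).
have nz n : n`!%:R != 0 :> K.
  by rewrite (iffLR (pcharf0P K) charK0) -lt0n fact_gt0.
rewrite -(@bin_fact (p + #|part_in (sval X) R|) p) ?leq_addr // addKn.
rewrite natrM invfM mulrAC mulVf ?mul1r ?natrM ?invfM //.
by rewrite (iffLR (pcharf0P K) charK0) -lt0n bin_gt0 leq_addr.
Qed.

Lemma exp_map_eps (T : finType) z : eps h T (exp_map z) = sym_eps z.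
Proof.
apply: (sym_ext (f := eps h T \o @exp_map T set0) (g := @sym_eps _ _ T)) => X x /=.
rewrite sym_eps_gen exp_map_gen /exp_fam.
have E : sval X = set0 by apply/eqP; rewrite -partition_set0; apply: (svalP X).
by rewrite (_ : #|sval X| = 0) ?E ?cards0 // fact0 invr1 scale1r /= sone_set0 eps_one0.
Qed.

Definition exp_mor : comonoid_mor (sym_comonoid (primitive h)) h :=
  @ComonoidMor K (sym_comonoid (primitive h)) h
    (@SpeciesMor K (sym_species (primitive h)) h
      (fun T A => @exp_map T A) (fun _ _ _ _ s x => exp_map_nat s x))
    (fun _ _ _ _ d x => exp_map_delta d x) exp_map_eps.
End Exponential.

(** * Attaching a block in S(q) *)

Section TensorAssocInverse.
Variables (K : fieldType) (U V W : lmodType K).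

(** The inverse associator. A swap followed by [tassoc] rotates the three factors cyclically; two
    rotations and a last swap restore their order with the other bracketing. *)
Definition tassocV : tens U (tens V W) -> tens (tens U V) W :=
  @tswap K _ _ \o @tassoc K _ _ _ \o @tswap K _ _ \o @tassoc K _ _ _ \o @tswap K _ _.
HB.instance Definition _ := GRing.Linear.on tassocV.

Lemma tassocVE u v w : tassocV (tpure u (tpure v w)) = tpure (tpure u v) w.
Proof. by rewrite /tassocV /= tswapE tassocE tswapE tassocE tswapE. Qed.
(** Naturality of the associator, in the form in which [tassoc], once introduced by coassociativity,
    cancels. *)
Lemma tassocV_tmap (U' V' W' : lmodType K) (f : {linear U' -> U})
    (g : {linear V' -> V}) (k : {linear W' -> W}) w :
  tassocV (tmap f (tmap g k) (tassoc w)) = tmap (tmap f g) k w.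
Proof.
apply: (@tens_ext K _ _ _ (tassocV \o (tmap f (tmap g k) \o @tassoc K U' V' W'))
  (tmap (tmap f g) k)) => x w' /=.
elim/(@tens_ind K): x => [|c x y IHx IHy|u v]; first by rewrite tpure0l !linear0.
  by rewrite tpurePl !linearP /= IHx IHy.
by rewrite tassocE !tmapE /= !tmapE tassocVE.
Qed.
End TensorAssocInverse.

Section SymGenerators.
Variables (K : fieldType) (q : species K) (T : finType).
Implicit Types (I S R : {set T}) (X Y : {set {set T}}).

Notation total := (forall B : {set T}, sp q B).

(* Indexing by all subsets spares casts between families over different
   partitions; junk value [0] when [X] is not a partition of [I]. *)
Definition tgen I X (xt : total) : sym_sp q I :=
  if @idP (partition X I) is ReflectT P
  then sgen (X := exist (fun X => partition X I) X P) (fun B => xt (sval B)) else 0.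

Arguments tgen : clear implicits.

Lemma tgenE I X (P : partition X I) xt :
  tgen I X xt = sgen (X := exist (fun X => partition X I) X P) (fun B => xt (sval B)).
Proof.
by rewrite /tgen; case: {-}_ / idP => // P'; rewrite (bool_irrelevance P' P).
Qed.

Lemma sgen_tgen I (X : parts I) (x : fam q (sval X)) :
  sgen x = tgen I (sval X) (tot x).
Proof.
rewrite (tgenE (svalP X)); apply: sgen_eq => // B BX BX'.
by rewrite /= (tot_in _ BX).
Qed.

Lemma tgen_ext I X xt yt : {in X, forall B, xt B = yt B} ->
  tgen I X xt = tgen I X yt.
Proof.
move=> h; rewrite /tgen; case: {-}_ / idP => // P.
by apply: sgen_eq => // B BX BX' /=; apply: h.
Qed.

Lemma tgen_sym_ext I (W : lmodType K) (f g : {linear sym_sp q I -> W}) :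
  (forall X xt, partition X I -> f (tgen I X xt) = g (tgen I X xt)) -> f =1 g.
Proof.
move=> h; apply: sym_ext => X x; rewrite sgen_tgen; apply: h; exact: (svalP X).
Qed.

Lemma tgen_linear I X xt (B : {set T}) : B \in X ->
  linear (fun z : sp q B => tgen I X (dfwith xt z)).
Proof.
move=> BX c x y; rewrite /tgen; case: {-}_ / idP => [P|_]; last by rewrite scaler0 addr0.
have E z : (fun C : {C | C \in X} => dfwith xt (i := B) z (sval C)) =
    dfwith (fun C : {C | C \in X} => xt (sval C)) (i := exist _ B BX) z.
  apply: functional_extensionality_dep => -[C CX] /=.
  have [E|BC] := eqVneq B C.
    by subst C; rewrite dfwith_in (bool_irrelevance CX BX) dfwith_in.
  by rewrite !dfwith_out.
by rewrite /sgen !E mtens_multilin linearP.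
Qed.

(** The zero default of [tgen] unites the two cases of the coproduct: if [X] is not compatible, then
    by [partition_compat] one of the two traces is not a partition, and its generator is 0. *)
Lemma delta_tgen I S R (d : decomp I S R) X xt : partition X I ->
  sym_delta d (tgen I X xt) =
  tpure (tgen S (part_in X S) xt) (tgen R (part_in X R) xt).
Proof.
move=> P; rewrite (tgenE P); set PX : parts I := exist _ _ _.
have [hc|nc] := boolP (compat X S R).
  rewrite (sym_delta_gen d (X := PX) _ hc).
  rewrite (tgenE (svalP (part_l d (X := PX) hc))).
  by rewrite (tgenE (svalP (part_r d (X := PX) hc))); congr tpure; apply: sgen_eq.
rewrite (sym_delta_gen0 _ (X := PX)) //.
have [PS|nS] := boolP (partition (part_in X S) S); last first.
  rewrite {1}/tgen; case: {-}_ / idP => [h|_]; first by rewrite h in nS.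
  by rewrite tpure0l.
have [PR|nR] := boolP (partition (part_in X R) R); last first.
  rewrite {2}/tgen; case: {-}_ / idP => [h|_]; first by rewrite h in nR.
  by rewrite tpure0r.
by rewrite (partition_compat P d PS PR) in nc.
Qed.

Lemma part_block_full I X B : partition X I -> I \in X -> B \in X -> B = I.
Proof.
move=> P IX BX; apply/eqP; apply: contraT => BI.
have /and3P[_ /trivIsetP tX _] := P.
have := tX _ _ BX IX BI; rewrite -setI_eq0 (setIidPl (part_block_sub P BX)).
by rewrite (negPf (part_block_neq0 P BX)).
Qed.

Section Projection.
Variable I : {set T}.

(** If [I] is a block, it is the only one, and the map is the evaluation of the single factor;
    otherwise the map is 0. *)
Lemma whole_multilin (X : parts I) :
  multilin (fun x : fam q (sval X) => tot x I).
Proof.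
move=> v [B BX] c x y; have [IX|IX] := boolP (I \in sval X); last first.
  by rewrite !tot_out // scaler0 addr0.
have E := part_block_full (svalP X) IX BX; move: BX x y; rewrite /= E => BX x y.
by rewrite !tot_dfwith /= !dfwith_in.
Qed.

(** The projection onto the one-block summand. Summing over all partitions, each of the others
    contributing 0, also covers the empty [I], which has no one-block partition. *)
Definition pi1 (z : sym_sp q I) : sp q I :=
  \sum_(X : parts I) mlift (@whole_multilin X) (z X).

Lemma pi1_linear : linear pi1.
Proof.
move=> c x y; rewrite /pi1 scaler_sumr -big_split /=; apply: eq_bigr => X _.
exact: (linearP (mlift (@whole_multilin X))).
Qed.

HB.instance Definition _ := GRing.isLinear.Build K (sym_sp q I)
  (sp q I) *:%R pi1 pi1_linear.

Lemma pi1_tgen X xt : partition X I ->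
  pi1 (tgen I X xt) = if I \in X then xt I else 0.
Proof.
move=> P; rewrite (tgenE P) /pi1 (bigD1 (exist _ X P : parts I)) //= big1 ?addr0.
  rewrite /sgen dinj_in mliftE; case: ifP => [IX|/negbT IX].
    by rewrite (tot_in _ IX).
  by rewrite tot_out.
by move=> Y YX; rewrite /sgen dinj_out ?linear0 // eq_sym.
Qed.

(** The inclusion of the one-block summand when [I] is nonempty. For [I] empty, [[set I]] is not a
    partition and the value is 0. *)
Definition single (v : sp q I) : sym_sp q I :=
  tgen I [set I] (dfwith (fun B => 0 : sp q B) v).

Lemma single_linear : linear single.
Proof. by apply: tgen_linear; rewrite set11. Qed.

HB.instance Definition _ := GRing.isLinear.Build K (sp q I)
  (sym_sp q I) *:%R single single_linear.
End Projection.

Section Insertion.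
Variables (I S R : {set T}) (d : decomp I S R).

Lemma block_neq (Y : parts R) (B : {B | B \in sval Y}) : sval B != S.
Proof.
have BR := part_block_sub (svalP Y) (svalP B).
apply: contraNneq (part_block_neq0 (svalP Y) (svalP B)) => E.
by rewrite (decomp_sub2 d _ BR) ?E.
Qed.

Lemma dfwithC (A : eqType) (V : A -> Type) (f : forall j, V j) (i j : A)
    (x : V i) (y : V j) : i != j ->
  dfwith (dfwith f x) y = dfwith (dfwith f y) x.
Proof.
move=> ij; apply: functional_extensionality_dep => k.
have [E|ik] := eqVneq i k.
  by subst k; rewrite dfwith_in dfwith_out 1?eq_sym // dfwith_in.
rewrite [RHS]dfwith_out //; have [E|jk] := eqVneq j k.
  by subst k; rewrite !dfwith_in.
by rewrite !dfwith_out.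
Qed.

(** No block of [Y] equals [S], so changing the family at a block commutes with setting its value at
    [S]. *)
Lemma ins_multilin (u : sp q S) (Y : parts R) : multilin
  (fun y : fam q (sval Y) => tgen I (S |: sval Y) (dfwith (tot y) u)).
Proof.
move=> v B c x y; rewrite !tot_dfwith !(dfwithC _ _ _ (block_neq B)).
by rewrite tgen_linear // !inE (svalP B) orbT.
Qed.

Definition ins (z : sym_sp q S) (w : sym_sp q R) : sym_sp q I :=
  \sum_(Y : parts R) mlift (@ins_multilin (pi1 z) Y) (w Y).

Lemma ins_linear z : linear (ins z).
Proof.
move=> c x y; rewrite /ins scaler_sumr -big_split /=; apply: eq_bigr => Y _.
exact: (linearP (mlift (@ins_multilin _ Y))).
Qed.

HB.instance Definition _ z := GRing.isLinear.Build K (sym_sp q R)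
  (sym_sp q I) *:%R (ins z) (ins_linear z).

Lemma ins_tgen z Y yt : partition Y R ->
  ins z (tgen R Y yt) = tgen I (S |: Y) (dfwith yt (pi1 z)).
Proof.
move=> P; rewrite (tgenE P) /ins (bigD1 (exist _ Y P : parts R)) //= big1 ?addr0.
  rewrite /sgen dinj_in mliftE /=; apply: tgen_ext => B.
  have [<-|SB] := eqVneq S B; first by rewrite !dfwith_in.
  rewrite !inE eq_sym (negPf SB) /= => BY.
  by rewrite !dfwith_out // (tot_in _ BY).
by move=> Z ZY; rewrite /sgen dinj_out ?linear0 // eq_sym.
Qed.

Lemma ins_bilin : bilin (fun p => ins p.1 p.2).
Proof.
split=> [w c x y|z]; last exact: ins_linear.
apply: (@tgen_sym_ext R _ (ins (c *: x + y)) (c \*: ins x \+ ins y)) => Y yt P /=.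
by rewrite !ins_tgen // linearP tgen_linear // setU11.
Qed.

(* Only the one-block component of the first factor is kept. *)
Definition attach : tens (sym_sp q S) (sym_sp q R) -> sym_sp q I := tlift ins_bilin.
HB.instance Definition _ := GRing.Linear.on attach.

Lemma attach_tgen z Y yt : partition Y R ->
  attach (tpure z (tgen R Y yt)) = tgen I (S |: Y) (dfwith yt (pi1 z)).
Proof. by move=> P; rewrite /attach tliftE ins_tgen. Qed.
End Insertion.
End SymGenerators.
Arguments tgen {K q T} I X xt.

(** * Coproducts of attached blocks, and recovery of an element of S(q) from its coproducts *)

Section Reconstruction.
Variables (K : fieldType) (q : species K) (T : finType).
Implicit Types (I S R : {set T}) (X Y : {set {set T}}).

Lemma delta_tgen0 I S R (d : decomp I S R) X xt : partition X I ->
  ~~ compat X S R -> sym_delta d (tgen I X xt : sym_sp q I) = 0.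
Proof.
move=> P nc; rewrite (tgenE P).
exact: (sym_delta_gen0 _ (X := exist _ X P : parts I)).
Qed.

Lemma tens_tgen_ext U R (W : lmodType K)
    (f g : {linear tens U (sym_sp q R) -> W}) :
  (forall u Y yt, partition Y R ->
     f (tpure u (tgen R Y yt)) = g (tpure u (tgen R Y yt))) -> f =1 g.
Proof.
move=> hfg; apply: tens_ext => u v.
exact: (@tgen_sym_ext K q T R W (f \o tpure u) (g \o tpure u) (hfg u)).
Qed.

(** The attached block [S] is cut by the decomposition, so no partition containing it is
    compatible. *)
Lemma delta_attach0 I S R S' R' (d : decomp I S R) (d' : decomp I S' R') w :
  ~~ (S \subset S') -> ~~ (S \subset R') ->
  sym_delta d' (attach (q := q) d w) = 0.
Proof.
move=> nS nR.
apply: (@tens_tgen_ext _ R _ (sym_delta d' \o attach (q := q) d) \0) => z Y yt P /=.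
have S0 : S != set0 by apply: contraNneq nS => ->; apply: sub0set.
rewrite attach_tgen // delta_tgen0 //; first exact: partition_setU1 d P S0.
by apply/negP => /forallP/(_ S); rewrite setU11 (negPf nS) (negPf nR).
Qed.

(** The block [S] lies in [S'], hence stays in the left factor, and only the rest on [R] is split,
    into its parts on [C] and on [R']. *)
Lemma delta_attach I S R S' R' C (d : decomp I S R) (d' : decomp I S' R')
    (d1 : decomp S' S C) (d2 : decomp R C R') w : S != set0 ->
  sym_delta d' (attach (q := q) d w) =
  tmap (attach (q := q) d1) idfun (tassocV (tmap idfun (@sym_delta _ q _ _ _ _ d2) w)).
Proof.
move=> S0; apply: (@tens_tgen_ext _ R _ (sym_delta d' \o attach (q := q) d)
  (tmap (attach (q := q) d1) idfun \o (@tassocV K _ _ _ \o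
     tmap idfun (@sym_delta _ q _ _ _ _ d2)))) => z Y yt P /=.
have SS' := decomp_subl d1; have CR := decomp_subl d2.
have PSY := partition_setU1 d P S0.
have SY := partition_notin d P S0.
(* The blocks of [Y] avoid [S], and [C] is what remains of [S'] once [S] is removed. *)
have BC B : B \in Y -> (B \subset S') = (B \subset C).
  move=> BY; have BR := part_block_sub P BY.
  apply/idP/idP => [BS|]; last by move/subset_trans; apply; apply: decomp_subr d1.
  apply/subsetP => u uB; have := subsetP BS u uB; rewrite (decompU u d1).
  case/orP => // uS; by have := subsetP BR u uB; rewrite (decompF d uS).
have nSR : (S \subset R') = false.
  by apply: contraNF S0 => SR'; rewrite (decomp_sub2 d' SS' SR').
rewrite attach_tgen // tmapE /= ; have [hc|nc] := boolP (compat Y C R'); last first.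
  rewrite !delta_tgen0 ?linear0 //.
  apply: contraNN nc => /forallP hc; apply/forallP => B; apply/implyP => BY.
  by have := hc B; rewrite !inE BY orbT /= BC.
rewrite !delta_tgen // tassocVE tmapE /= attach_tgen; last first.
  exact: part_in_partition P d2 hc.
have -> : part_in (S |: Y) S' = S |: part_in Y C.
  apply/setP => B; rewrite !inE; have [->|] := eqVneq B S; first by rewrite SS'.
  by move=> _ /=; case: (boolP (B \in Y)) => //= /BC.
have -> : part_in (S |: Y) R' = part_in Y R'.
  apply/setP => B; rewrite !inE; have [->|//] := eqVneq B S.
  by rewrite nSR !andbF.
congr tpure; apply: tgen_ext => B; rewrite inE => /andP[BY _].
by rewrite dfwith_out //; apply: contraNneq SY => ->.
Qed.

Lemma pi1_tgen0 I X xt : I \notin X -> pi1 (tgen I X xt : sym_sp q I) = 0.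
Proof.
move=> IX; have [P|P] := boolP (partition X I).
  by rewrite pi1_tgen // (negPf IX).
by rewrite /tgen; case: {-}_ / idP => [h|_]; [rewrite h in P|rewrite linear0].
Qed.

Lemma attach_pi1_0 I S R (d : decomp I S R) (z : sym_sp q S) w :
  pi1 z = 0 -> attach d (tpure z w) = 0.
Proof.
have E0 : pi1 (0 : sym_sp q S) = 0 by apply: linear0.
move=> z0; rewrite -[RHS](linear0 (attach (q := q) d)) -(tpure0l (sym_sp q S) w).
by rewrite /= /attach !tliftE /ins /= z0 E0.
Qed.

Lemma part_in_full X I : partition X I -> part_in X I = X.
Proof.
move=> P; apply/setP => B; rewrite inE; case: (boolP (B \in X)) => //= BX.
exact: part_block_sub P BX.
Qed.

(** Here [R] is empty: the first factor is all of [z], and attaching keeps only its one-block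
    component. *)
Lemma attach_single I R (d : decomp I I R) z :
  attach d (sym_delta d z) = single (pi1 z) :> sym_sp q I.
Proof.
apply: (@tgen_sym_ext K q T I _ (attach (q := q) d \o @sym_delta _ q _ _ _ _ d)
  (@single K q T I \o @pi1 K q T I)) => X xt P /=.
have E : R = set0 by rewrite (decomp_setD d) setDv.
subst R; have c0 : part_in X set0 = set0.
  apply/setP => B; rewrite !inE subset0; apply/negP => /andP[BX].
  by rewrite (negPf (part_block_neq0 P BX)).
rewrite delta_tgen // c0 part_in_full // attach_tgen ?partition_set0 // setU0.
apply: tgen_ext => B; rewrite inE => /eqP ->; rewrite !dfwith_in //.
Qed.

Definition rec_term I S (z : sym_sp q I) : sym_sp q I :=
  if @idP (S \subset I) is ReflectT SI
  then attach (decompD SI) (sym_delta (decompD SI) z) else 0.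

Lemma rec_term_linear I S : linear (@rec_term I S).
Proof.
move=> c x y; rewrite /rec_term; case: {-}_ / idP => [SI|_].
  by rewrite !linearP.
by rewrite scaler0 addr0.
Qed.

HB.instance Definition _ I S := GRing.isLinear.Build K (sym_sp q I)
  (sym_sp q I) *:%R (@rec_term I S) (@rec_term_linear I S).

Lemma rec_termE I S R (d : decomp I S R) z : rec_term S z = attach d (sym_delta d z).
Proof.
have E := decomp_setD d; subst R; rewrite /rec_term.
case: {-}_ / idP => [SI|/negP]; last by rewrite (decomp_subl d).
by rewrite (bool_irrelevance (decompD SI) d).
Qed.

Lemma rec_term0 I S (z : sym_sp q I) : ~~ (S \subset I) -> rec_term S z = 0.
Proof.
by rewrite /rec_term; case: {-}_ / idP => // SI; rewrite SI.
Qed.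

Definition reconstruct I a (z : sym_sp q I) : sym_sp q I :=
  \sum_(S : {set T} | a \in S) rec_term S z.

Lemma reconstruct_linear I a : linear (@reconstruct I a).
Proof.
move=> c x y; rewrite /reconstruct scaler_sumr -big_split /=.
by apply: eq_bigr => S _; rewrite linearP.
Qed.

HB.instance Definition _ I a := GRing.isLinear.Build K (sym_sp q I)
  (sym_sp q I) *:%R (@reconstruct I a) (@reconstruct_linear I a).

(** On a generator over [X], the term at [S] vanishes unless [S] is a block of [X], because of
    [pi1]. Exactly one block contains [a], and its term detaches that block and puts it back. *)
Lemma reconstructE I a (z : sym_sp q I) : a \in I -> reconstruct a z = z.
Proof.
move=> aI; apply: (@tgen_sym_ext K q T I _ (@reconstruct I a) idfun) => X xt P /=.
have /and3P[/eqP cX /trivIsetP tX X0] := P.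
have : a \in cover X by rewrite cX.
case/bigcupP => S SX aS.
have SI := part_block_sub P SX; have d := decompD SI.
rewrite /reconstruct (bigD1 S) //= big1 ?addr0 => [|Q /andP[aQ QS]]; last first.
  have [QI|QI] := boolP (Q \subset I); last exact: rec_term0.
  rewrite (rec_termE (decompD QI)) delta_tgen // attach_pi1_0 // pi1_tgen0 //.
  rewrite inE subxx andbT; apply/negP => QX.
  by rewrite (disjointFr (tX _ _ QX SX QS) aQ) in aS.
have hc : compat X S (I :\: S).
  apply/forallP => B; apply/implyP => BX; have [->|BS] := eqVneq B S.
    by rewrite subxx.
  by rewrite subsetD (part_block_sub P BX) (tX _ _ BX SX BS) orbT.
have PS : partition (part_in X S) S by apply: part_in_partition P d hc.
have PR : partition (part_in X (I :\: S)) (I :\: S).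
  by rewrite decompC in d; rewrite compatC in hc; apply: part_in_partition P d hc.
rewrite (rec_termE d) delta_tgen // attach_tgen //.
have S0 := part_block_neq0 P SX.
rewrite pi1_tgen // inE SX subxx /=.
rewrite (@partition_part_in _ X (S |: part_in X (I :\: S)) I I) //; last 2 first.
- by rewrite subUset sub1set SX part_in_sub.
- exact: partition_setU1 d PR S0.
rewrite part_in_full //; apply: tgen_ext => B BX.
by have [<-|SB] := eqVneq S B; [rewrite dfwith_in|rewrite dfwith_out].
Qed.

Lemma tmap_rec_term I (V : lmodType K) a (w : tens (sym_sp q I) V) : a \in I ->
  \sum_(S : {set T} | a \in S) tmap (@rec_term I S) idfun w = w.
Proof.
move=> aI; elim/(@tens_ind K): w => [|c x y IHx IHy|u v].
- by rewrite big1 // => S _; rewrite linear0.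
- rewrite -{2}IHx -{2}IHy scaler_sumr -big_split /=.
  by apply: eq_bigr => S _; rewrite linearP.
under eq_bigr => S _ do rewrite tmapE /=.
by rewrite -tpure_suml; congr tpure; apply: reconstructE.
Qed.
End Reconstruction.

(** * Invertibility *)

Lemma exp_map_single (K : fieldType) (h : bimonoid K) (T : finType)
    (I : {set T}) (v : prim h I) : I != set0 ->
  exp_map (single (q := primitive h) v) = pval v.
Proof.
move=> I0; have P : partition [set I] I.
  have := partition_setU1 (decompD (subxx I)) (Y := set0) _ I0.
  by rewrite setU0 setDv partition_set0; apply.
rewrite /single (tgenE P) exp_map_gen /exp_fam /= cards1 (_ : 1`! = 1)%N //.
rewrite invr1 scale1r.
rewrite [spow _ 1]/= mul_sone /block_ser (tot_in _ (set11 I)) /=.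
by rewrite dfwith_in.
Qed.

(** * Inverting a comonoid morphism that extends the inclusion of the primitive part *)

Section Inverse.
Variables (K : fieldType) (h : bimonoid K).
Hypotheses (h_cocomm : cocommutative h) (h_conn : connected h).
Variable f : comonoid_mor (sym_comonoid (primitive h)) h.
Hypothesis f_single : forall (T : finType) (I : {set T}) (v : prim h I),
  I != set0 -> f T I (single (q := primitive h) v) = pval v.

Local Notation q := (primitive h).

Section Ambient.
Variable T : finType.
Implicit Types (I S R : {set T}).

(** The inverse is required as a linear map, so that [tmap] can be applied to it. *)
Definition invertible I := exists g : {linear sp h I -> sym_sp q I},
  cancel (f T I) g /\ cancel g (f T I).

Lemma f_delta I S R (d : decomp I S R) z :
  delta h d (f T I z) = tmap (f T S) (f T R) (@sym_delta _ q _ _ _ _ d z).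
Proof. exact: cmor_delta. Qed.

Lemma f_eps z : eps h T (f T set0 z) = sym_eps z.
Proof. exact: (cmor_eps f). Qed.

Definition sym_one : sym_sp q (set0 : {set T}) := tgen set0 set0 (fun=> 0).

Lemma sym_eps_one : sym_eps sym_one = 1.
Proof. by rewrite /sym_one (tgenE (part0_subproof T)) sym_eps_gen. Qed.

(** Packaged as a linear map so that its equality with the identity can be checked on generators;
    this shows that [sym_one] spans. *)
Definition eps_one (z : sym_sp q (set0 : {set T})) : sym_sp q (set0 : {set T}) :=
  (sym_eps z : K) *: sym_one.

Lemma eps_one_linear : linear eps_one.
Proof. by move=> c x y; rewrite /eps_one linearP scalerDl scalerA. Qed.

HB.instance Definition _ := GRing.isLinear.Build K (sym_sp q (set0 : {set T}))
  (sym_sp q (set0 : {set T})) *:%R eps_one eps_one_linear.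

Lemma eps_oneE z : eps_one z = z.
Proof.
apply: (@tgen_sym_ext K q T set0 _ eps_one idfun) => X xt P /=.
have X0 : X = set0 by apply/eqP; rewrite -partition_set0.
subst X; rewrite /eps_one (tgenE P) sym_eps_gen scale1r -(tgenE P) /sym_one.
by apply: tgen_ext => B; rewrite inE.
Qed.

(** On the empty set, source and target are lines on which the counit is an isomorphism, and [f]
    preserves counits. *)
Lemma invertible0 : invertible set0.
Proof.
apply: bijective_linear => [x y E|y].
  by rewrite -[x]eps_oneE -[y]eps_oneE /eps_one -!f_eps E.
exists ((eps h T y : K) *: sym_one); rewrite linearZ /=.
rewrite [RHS](connectedE h_conn) [f T set0 sym_one](connectedE h_conn).
by rewrite f_eps sym_eps_one scale1r.
Qed.

Section Step.
Variables (I : {set T}) (a : T) (aI : a \in I).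
Hypothesis IH : forall S, S \proper I -> invertible S.

(** Defined for every [S], with default value 0, so that terms carry no proof of properness; only
    proper subsets of [I] matter. *)
Definition local_inv S : {linear sp h S -> sym_sp q S} :=
  if pselect (invertible S) is left gP then sval (cid gP) else \0.

Lemma local_invK S : S \proper I -> cancel (f T S) (local_inv S).
Proof.
move=> /IH SI; rewrite /local_inv; case: pselect => // gP.
by case: (cid gP) => g [].
Qed.

Lemma f_local_invK S : S \proper I -> cancel (local_inv S) (f T S).
Proof.
move=> /IH SI; rewrite /local_inv; case: pselect => // gP.
by case: (cid gP) => g [].
Qed.

Lemma properl S R : decomp I S R -> R != set0 -> S \proper I.
Proof.
move=> d R0; rewrite properE (decomp_subl d); apply: contraNN R0 => IS.
by rewrite (decomp_sub2 d _ (subxx R)) // (subset_trans (decomp_subr d)).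
Qed.

Lemma properr S R : decomp I S R -> S != set0 -> R \proper I.
Proof. by rewrite decompC; apply: properl. Qed.

Lemma delta_local_inv U S R (d : decomp U S R) y : U \proper I ->
  @sym_delta _ q _ _ _ _ d (local_inv U y) =
  tmap (local_inv S) (local_inv R) (delta h d y).
Proof.
move=> UI; have SI := sub_proper_trans (decomp_subl d) UI.
have RI := sub_proper_trans (decomp_subr d) UI.
rewrite -[in RHS](f_local_invK UI y) f_delta.
by rewrite (tmap_can (local_invK SI) (local_invK RI)).
Qed.

Lemma I_neq0 : I != set0.
Proof. by apply/set0Pn; exists a. Qed.

Lemma step_injective : injective (f T I).
Proof.
apply: raddf_inj => z fz0.
have zE : z = single (pi1 z).
  rewrite -{1}(reconstructE z aI) /reconstruct (bigD1 I) //= big1 ?addr0.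
    by rewrite (rec_termE (decompD (subxx I))) attach_single.
  move=> S /andP[aS SI]; have [SI'|] := boolP (S \subset I); last exact: rec_term0.
  have d := decompD SI'; have S0 : S != set0 by apply/set0Pn; exists a.
  have R0 : I :\: S != set0.
    by rewrite setD_eq0; apply: contraNN SI => IS; rewrite eqEsubset SI'.
  rewrite (rec_termE d) (_ : sym_delta d z = 0) ?linear0 //.
  (* Both parts are proper, so the tensor product of the two components of [f] is injective; it
     sends this coproduct of [z] to that of [f z], which is 0. *)
  apply: (can_inj (tmap_can (local_invK (properl d R0)) (local_invK (properr d S0)))).
  by rewrite -f_delta fz0 !linear0.
suff p0 : pi1 z = 0 by rewrite zE p0 linear0.
by apply: val_inj; rewrite /= -(f_single _ I_neq0) -zE.
Qed.

Section Preimage.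
Variable y : sp h I.

(** The coproduct that any preimage of [y] must have when [S] and [R] are proper. *)
Definition inv_delta S R (d : decomp I S R) : tens (sym_sp q S) (sym_sp q R) :=
  tmap (local_inv S) (local_inv R) (delta h d y).

Definition glue_term S : sym_sp q I :=
  if @idP (S \subset I) is ReflectT SI
  then attach (decompD SI) (inv_delta (decompD SI)) else 0.

(** The formula of [reconstruct], with [inv_delta] in place of the coproducts of the unknown
    preimage. The term at [I] is left out: it would need the inverse on [I] itself. *)
Definition glue : sym_sp q I :=
  \sum_(S : {set T} | (a \in S) && (S != I)) glue_term S.

(** If [S] is not inside [S'], both sides are 0. Otherwise [delta_attach] splits the rest of the
    glued term, and coassociativity of [h] rewrites the result as detaching and reattaching [S] in
    the first factor of [inv_delta d']. *)
Lemma delta_glue_term S S' R' (d' : decomp I S' R') :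
  a \in S' -> R' != set0 -> a \in S -> S != I ->
  sym_delta d' (glue_term S) =
  tmap (@rec_term K q T S' S) idfun (inv_delta d').
Proof.
move=> aS' R0' aS SI; rewrite /glue_term; case: {-}_ / idP => [SsI|/negP SnI]; last first.
  rewrite linear0; elim/(@tens_ind K): (inv_delta d') => [|c u v IHu IHv|u v].
  - by rewrite linear0.
  - by rewrite linearP /= -IHu -IHv scaler0 addr0.
  rewrite tmapE /= rec_term0 ?tpure0l //.
  by apply: contraNN SnI => SS'; apply: subset_trans SS' (decomp_subl d').
have d := decompD SsI; rewrite (bool_irrelevance (decompD SsI) d).
have S0 : S != set0 by apply/set0Pn; exists a.
have [SS'|nSS'] := boolP (S \subset S'); last first.
  rewrite delta_attach0 //; last first.
    by apply/negP => /subsetP/(_ a aS); rewrite (decompF d' aS').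
  elim/(@tens_ind K): (inv_delta d') => [|c u v IHu IHv|u v].
  - by rewrite linear0.
  - by rewrite linearP /= -IHu -IHv scaler0 addr0.
  by rewrite tmapE /= rec_term0 ?tpure0l.
have d1 := decompD SS'; have d2 : decomp (I :\: S) (S' :\: S) R'.
  apply: decompP => x; rewrite !inE.
    have/implyP := @decompN _ _ _ _ x d'; have/implyP := subsetP SS' x.
    rewrite (decompU x d').
    by case: (x \in S'); case: (x \in R'); case: (x \in S).
  by case/andP => _ /(decompF d') ->.
have S'I := properl d' R0'; have SpI : S \proper I by rewrite properEneq SI.
have S0' : S' != set0 by apply/set0Pn; exists a.
have RpI := properr d S0; have R'I := properr d' S0'.
rewrite (delta_attach d d' d1 d2) // /inv_delta.
(* The local inverses are moved outside the coproduct along [d2], coassociativity is applied inside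
   [h], and the inverses are then moved back inside the coproduct along [d1]. *)
rewrite (@tmap_square _ _ _ _ _ _ _ _ _ idfun (@sym_delta _ q _ _ _ _ d2)
  (local_inv S) (local_inv _)
  (local_inv S) (tmap (local_inv (S' :\: S)) (local_inv R')) idfun (delta h d2)) //; last first.
  by move=> v /=; rewrite delta_local_inv.
rewrite -(delta_coassoc h d' d1 d d2 y).
rewrite tassocV_tmap.
rewrite (@tmap_square _ _ _ _ _ _ _ _ _ _ _ _ _ (@sym_delta _ q _ _ _ _ d1) idfun
  (local_inv S') (local_inv R')) //; last by move=> u /=; rewrite delta_local_inv.
rewrite (@tmap_square _ _ _ _ _ _ _ _ _ _ _ _ _ (@rec_term K q T S' S) idfun
  idfun idfun) //; last by move=> u /=; rewrite (rec_termE d1).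
by rewrite (@tmap_id _ _ _ idfun idfun).
Qed.

Lemma delta_glue S' R' (d' : decomp I S' R') : a \in S' -> R' != set0 ->
  sym_delta d' glue = inv_delta d'.
Proof.
move=> aS' R0'; rewrite /glue linear_sum /=.
under eq_bigr => S /andP[aS SI] do rewrite (delta_glue_term d' aS' R0' aS SI).
(* As [a] is in [S'], the right-hand side can be reconstructed in its first factor; the additional
   term at [I] vanishes since [I] is not inside [S']. *)
rewrite -[RHS](tmap_rec_term _ aS') [RHS](bigD1 I) ?aI //=.
rewrite [X in _ = X + _](_ : _ = 0) ?add0r //.
elim/(@tens_ind K): (inv_delta d') => [|c u v IHu IHv|u v].
- by rewrite linear0.
- by rewrite linearP /= IHu IHv scaler0 addr0.
rewrite tmapE /= rec_term0 ?tpure0l //.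
by have := properl d' R0'; rewrite properE => /andP[].
Qed.

Lemma glue_defect_primitive : is_primitive (y - f T I glue).
Proof.
rewrite /is_primitive ifN ?I_neq0 //; apply/asboolP => S R.
have H U V (d : decomp I U V) : a \in U -> V != set0 -> delta h d (y - f T I glue) = 0.
  move=> aU V0; rewrite linearB /= f_delta delta_glue // /inv_delta.
  have U0 : U != set0 by apply/set0Pn; exists a.
  by rewrite (tmap_can (f_local_invK (properl d V0)) (f_local_invK (properr d U0)))
             subrr.
(* If [a] is in [R] instead, cocommutativity turns the coproduct for [(S, R)] into the swap of the
   one for [(R, S)]. *)
move=> d S0 R0; move: aI; rewrite (decompU a d) => /orP[aS|aR]; first exact: H.
have d' : decomp I R S by rewrite decompC.
by rewrite (h_cocomm d' d) H // linear0.
Qed.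

Lemma step_surjective : exists z, f T I z = y.
Proof.
(* The defect is primitive, so it is the image of its own one-block element. *)
exists (glue + single (Prim glue_defect_primitive : sp q I)).
by rewrite linearD /= f_single ?I_neq0 //= addrC subrK.
Qed.
End Preimage.
End Step.

Lemma invertibleT I : invertible I.
Proof.
have [n] := ubnP #|I|; elim: n I => // n IH I; rewrite ltnS => In.
have [->|/set0Pn[a aI]] := eqVneq I set0; first exact: invertible0.
have IH' S : S \proper I -> invertible S.
  by move=> /proper_card SI; apply: IH; apply: leq_trans SI In.
apply: bijective_linear; first exact: step_injective aI IH'.
exact: step_surjective aI IH'.
Qed.
End Ambient.

Definition inv_map (T : finType) (I : {set T}) : {linear sp h I -> sym_sp q I} :=
  sval (cid (invertibleT I)).

Lemma inv_mapK (T : finType) (I : {set T}) : cancel (f T I) (inv_map I).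
Proof. by rewrite /inv_map; case: cid => g []. Qed.

Lemma f_invK (T : finType) (I : {set T}) : cancel (inv_map I) (f T I).
Proof. by rewrite /inv_map; case: cid => g []. Qed.

Lemma inv_map_nat (T T' : finType) (A : {set T}) (B : {set T'}) (s : fbij A B) x :
  inv_map B (sp_map h s x) = sp_map (sym_species q) s (inv_map A x).
Proof.
by apply: (can_inj (@inv_mapK _ B)); rewrite f_invK mor_nat f_invK.
Qed.

Lemma inv_map_delta (T : finType) (I S R : {set T}) (d : decomp I S R) x :
  delta (sym_comonoid q) d (inv_map I x) =
  tmap (inv_map S) (inv_map R) (delta h d x).
Proof.
rewrite -[in RHS](f_invK x) cmor_delta.
by rewrite (tmap_can (@inv_mapK _ S) (@inv_mapK _ R)).
Qed.

Lemma inv_map_eps (T : finType) x :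
  eps (sym_comonoid q) T (inv_map set0 x) = eps h T x.
Proof. by rewrite -[in RHS](f_invK x) cmor_eps. Qed.

Lemma comonoid_mor_iso : is_comonoid_iso f.
Proof.
exists (@ComonoidMor K h (sym_comonoid q)
  (@SpeciesMor K h (sym_species q) (fun T A => @inv_map T A)
    (fun _ _ _ _ s x => inv_map_nat s x))
  (fun _ _ _ _ d x => inv_map_delta d x) inv_map_eps).
by split=> T A; [apply: inv_mapK|apply: f_invK].
Qed.
End Inverse.

Theorem theorem118 (K : fieldType) (charK0 : [pchar K]%R =i pred0)
    (h : bimonoid K) (h_cocomm : cocommutative h) (h_conn : connected h) :
  exists f : comonoid_mor (sym_comonoid (primitive h)) h, is_comonoid_iso f.
Proof.
exists (exp_mor charK0 h_conn); apply: comonoid_mor_iso => // T I v.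
exact: exp_map_single.
Qed.
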